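(* Let $H$ be a real Hilbert space, $E$ a real Banach space, $S\in\gamma(H,E)$, and $\mathcal T\subseteq\mathcal L(H,E)$ a set such that $\|T^*x^*\|\le\|S^*x^*\|$ for all $T\in\mathcal T$ and $x^*\in E^*$. Then $\mathcal T$ is relatively compact in $\gamma(H,E)$ if and only if for every $x^*\in E^*$ the set $\{T^*x^*:T\in\mathcal T\}$ is relatively compact in $H$.
   Context: $H$ is identified with its dual, so $T^*:E^*\to H$. $\gamma(H,E)$ is the completion of $H\otimes E$ under $\|\sum_{n=1}^N h_n\otimes x_n\|_{\gamma(H,E)}^2:=\mathbb E\|\sum_{n=1}^N\gamma_n x_n\|^2$ ($h_n$ orthonormal, $\gamma_n$ independent standard Gaussians), identified with a subspace of $\mathcal L(H,E)$. *)

(* Defs.v *)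
From HB Require Import structures.
From mathcomp Require Import all_boot all_order all_algebra.
From mathcomp Require Import all_classical all_reals all_analysis.
Set Implicit Arguments. Unset Strict Implicit. Unset Printing Implicit Defensive.
Import Order.TTheory GRing.Theory Num.Theory.
Import numFieldNormedType.Exports.
Local Open Scope classical_set_scope.
Local Open Scope ring_scope.

Section gamma_defs.
Variables (R : realType) (H E : normedModType R).

Definition is_linear (V W : lmodType R) (f : V -> W) :=
  forall (a : R) (u v : V), f (a *: u + v) = a *: f u + f v.

Definition bounded_linear (V W : normedModType R) (f : V -> W) :=
  is_linear f /\ continuous f.

Definition dual_elt (x : E -> R^o) := bounded_linear x.

(* ip is an inner product on H inducing the norm of H
   (together with completeness of H this makes H a real Hilbert space) *)
Definition inner_product (ip : H -> H -> R) :=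
  [/\ forall x y, ip x y = ip y x,
      forall a x y z, ip (a *: x + y) z = a * ip x z + ip y z &
      forall x, ip x x = `|x| ^+ 2].

(* T^* x^* : the element of H (identified with H^* via ip) representing
   k |-> x^*(T k) *)
Definition adj (ip : H -> H -> R) (T : H -> E) (xs : E -> R) : H :=
  xget 0 [set h | forall k, ip h k = xs (T k)].

Definition orthonormal (ip : H -> H -> R) N (h : 'I_N -> H) :=
  forall i j, ip (h i) (h j) = (i == j)%:R.

(* iterated integral against N independent standard Gaussians
   (coordinates 0 .. n-1 are integrated) *)
Fixpoint gauss_int (n : nat) (F : (nat -> R) -> \bar R) : \bar R :=
  match n with
  | 0 => F (fun _ => 0)
  | n'.+1 => (\int[normal_prob (0:R) 1]_t
                gauss_int n' (fun v => F (fun i => if i == n' then t else v i)))%E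
  end.

Definition gauss_sq N (x : 'I_N -> E) : \bar R :=
  gauss_int N (fun t => (`| \sum_(i < N) t i *: x i | ^+ 2)%:E).

Definition fr_repr (ip : H -> H -> R) (T : H -> E) N (h : 'I_N -> H) (x : 'I_N -> E) :=
  orthonormal ip h /\ forall k, T k = \sum_(i < N) ip k (h i) *: x i.

Definition finite_rank ip (T : H -> E) := exists N h x, @fr_repr ip T N h x.

Definition fr_gnorm ip (T : H -> E) : R :=
  Num.sqrt (fine (xget 0%E
    [set c | exists N h x, @fr_repr ip T N h x /\ c = gauss_sq x])).

Definition fsub (T U : H -> E) : H -> E := fun k => T k - U k.

Definition gamma_approx ip (Tk : nat -> H -> E) (T : H -> E) :=
  [/\ forall k, finite_rank ip (Tk k),
      forall e : R, 0 < e -> exists K, forall m n, (K <= m)%N -> (K <= n)%N ->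
        fr_gnorm ip (fsub (Tk m) (Tk n)) < e &
      forall k, (fun n => Tk n k) @ \oo --> T k].

(* membership in gamma(H,E), the completion identified with a subspace of L(H,E) *)
Definition in_gamma ip (T : H -> E) := exists Tk, gamma_approx ip Tk T.

Definition gnorm ip (T : H -> E) : R :=
  xget 0 [set c | exists Tk, gamma_approx ip Tk T /\
                   (fun n => fr_gnorm ip (Tk n)) @ \oo --> c].

Definition rel_compact_gamma ip (A : set (H -> E)) :=
  A `<=` in_gamma ip /\
  forall u : nat -> H -> E, (forall j, A (u j)) ->
    exists phi : nat -> nat, {homo phi : m n / (m < n)%N >-> (m < n)%N} /\
    exists T, in_gamma ip T /\
      (fun j => gnorm ip (fsub (u (phi j)) T)) @ \oo --> 0.

End gamma_defs.

(* Main.v *)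
(* Gaussian sums are rotation invariant, so Jensen's inequality makes the
   gamma norm monotone under domination: |T^* x^*| <= |S^* x^*| for all x^* gives
   |T| <= |S| in gamma(H,E), first for finite rank operators.  For
   finitely many functionals x_i with S^* x_i orthonormal put
   Q e = sum_i x_i(e) S S^* x_i; then Q S = S P with P the projection onto the span
   of the S^* x_i, and the same monotonicity gives |Q' T - Q T| <= |Q' S - Q S|
   for every dominated T whenever Q' refines Q.  Since S is a gamma limit of
   finite rank operators, the right-hand side is uniformly small for a suitable
   Q, so the finite rank operators Q T approximate all T in the family
   uniformly, and Q T depends only on the finitely many vectors T^* x_i, which
   range over relatively compact sets.  Hahn-Banach identifies the limit of
   Q T with T. *)
Require Import Defs.
From HB Require Import structures.
From mathcomp Require Import all_boot all_order all_algebra.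
From mathcomp Require Import all_classical all_reals all_analysis.
From mathcomp Require Import measurable_realfun ring lra.
Set Implicit Arguments. Unset Strict Implicit. Unset Printing Implicit Defensive.
Import Order.TTheory GRing.Theory Num.Theory.
Import numFieldNormedType.Exports.
Local Open Scope classical_set_scope.
Local Open Scope ring_scope.

(** * One- and two-dimensional Gaussian integrals *)

(** Three obstacles shape the proof. First, [E] need not be separable and carries no sigma-algebra,
    so there are no random vectors: everything is an iterated integral of a real function of the
    Gaussian coordinates, and rotation invariance is built up from the plane by Givens rotations. A
    contraction matrix is compared with an isometry by adding rows to it; the isometry preserves the
    Gaussian norm and deleting the added rows can only lower it. Second, an element of the
    completion is an operator, so its norm is meaningful only if a norm-Cauchy sequence of finite
    rank operators that tends to 0 pointwise also tends to 0 in norm. Third, [Q] acts on [E] and not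
    on [H]: cutting [T] down to [T P] would need a projection [P] suited to all [T] at once, whereas
    [Q T] sees [T] only through the vectors [T^* x_i], to which domination applies. The quality of
    [Q] is measured on [S] alone, hence is uniform over the family; systems chosen for different
    accuracies need not be nested, so they are compared through a common refinement. *)

Section normal_integral.
Context {R : realType}.
Implicit Types f : measurableTypeR R -> \bar R.
Notation mu := (@lebesgue_measure R).
Notation gam := (normal_prob (0 : R) 1).
Notation pdf := (normal_pdf (0 : R) 1).

Import HBNNSimple.

Let integral_normal_nnsfun (f : {nnsfun measurableTypeR R >-> R}) :
  (\int[gam]_x (f x)%:E = \int[mu]_x ((f x)%:E * (pdf x)%:E))%E.
Proof.
under [LHS]eq_integral do rewrite fimfunE -fsumEFin//.
rewrite [LHS]ge0_integral_fsum//; last 2 first.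
  - by move=> r; exact/measurable_EFinP/measurableT_comp.
  - by move=> n x _; rewrite EFinM nnfun_muleindic_ge0.
under [RHS]eq_integral.
  move=> x xD; rewrite fimfunE -fsumEFin// ge0_mule_fsuml; last first.
    by move=> r; rewrite EFinM nnfun_muleindic_ge0.
  over.
have mpdf : measurable_fun [set: measurableTypeR R] pdf by exact: measurable_normal_pdf.
rewrite [RHS]ge0_integral_fsum//; last 2 first.
  - move=> r; apply: emeasurable_funM; apply/measurable_EFinP => //.
    exact: measurableT_comp.
  - move=> n x _; rewrite mule_ge0//; first by rewrite EFinM nnfun_muleindic_ge0.
    by rewrite lee_fin normal_pdf_ge0.
apply: eq_fsbigr => r _.
rewrite integralZl_indic_nnsfun//= integral_indic//= setIT /normal_prob.
have [r0|r0] := ltP r 0.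
  rewrite preimage_nnfun0// integral_set0 mule0.
  apply/esym/integral0_eq => x _; rewrite indicE in_set0.
  by rewrite mulr0 mul0e.
rewrite integral_mkcond/= -ge0_integralZl//=; last 2 first.
- apply/(measurable_restrictT _ _).1 => //.
  exact/measurable_EFinP/measurable_funTS.
- by move=> x _; rewrite patchE; case: ifP => // _; rewrite lee_fin normal_pdf_ge0.
apply: eq_integral => x _; rewrite patchE indicE EFinM.
by case: ifP => _; rewrite ?mule1 ?mule0 ?mul0e.
Qed.

(** Integration against a density, by the standard route: simple functions first, then monotone
    convergence on both sides. *)
Lemma integral_normal f : measurable_fun [set: measurableTypeR R] f -> (forall x, 0 <= f x)%E ->
  (\int[gam]_x f x = \int[mu]_x (f x * (pdf x)%:E))%E.
Proof.
move=> mf f0.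
have mpdf : measurable_fun [set: measurableTypeR R] pdf by exact: measurable_normal_pdf.
pose f_ := nnsfun_approx measurableT mf.
transitivity (lim (\int[gam]_x (f_ n x)%:E @[n --> \oo])%E).
  rewrite -monotone_convergence//=.
  - apply: eq_integral => ? /[!inE] xD; apply/esym/cvg_lim => //=.
    exact: cvg_nnsfun_approx.
  - by move=> n; exact/measurable_EFinP/measurable_funTS.
  - by move=> n ? _; rewrite lee_fin.
  - by move=> ? _ ? ? mn; rewrite lee_fin; exact/lefP/nd_nnsfun_approx.
rewrite [RHS](_ : _ = lim
    (\int[mu]_x ((f_ n x)%:E * (pdf x)%:E) @[n --> \oo])%E); last first.
  rewrite -monotone_convergence//=.
  - apply: eq_integral => x /[!inE] xD; apply/esym/cvg_lim => //.
    by apply: cvgeZr => //; exact: cvg_nnsfun_approx.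
  - move=> n; apply: emeasurable_funM; apply/measurable_EFinP => //.
  - by move=> n x _; rewrite mule_ge0// lee_fin// normal_pdf_ge0.
  - move=> x _ a b mn; rewrite lee_wpmul2r ?lee_fin ?normal_pdf_ge0//.
    exact/lefP/nd_nnsfun_approx.
by apply: congr_lim; apply/funext => n /=; exact: integral_normal_nnsfun.
Qed.

(** Lebesgue measure is determined by its values on half-open intervals, so invariance under [phi]
    has to be tested on these only. *)
Lemma integral_lebesgueT (phi : measurableTypeR R -> measurableTypeR R) f : measurable_fun setT phi ->
  (forall A, ocitv A -> mu A = pushforward mu phi A) ->
  measurable_fun [set: measurableTypeR R] f -> (forall x, 0 <= f x)%E ->
  (\int[mu]_x f (phi x) = \int[mu]_x f x)%E.
Proof.
move=> mphi phiE mf f0.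
pose h : {mfun measurableTypeR R >-> measurableTypeR R} :=
  HB.pack phi (isMeasurableFun.Build _ _ (measurableTypeR R) (measurableTypeR R) phi mphi).
rewrite -[LHS](ge0_integral_pushforward mphi mu measurableT mf)//.
apply: eq_measure_integral => //= A mA _.
exact: (esym (lebesgue_measure_unique (mu := pushforward mu h) phiE mA)).
Qed.

Lemma integral_lebesgueD (a : R) f :
  measurable_fun [set: measurableTypeR R] f -> (forall x, 0 <= f x)%E ->
  (\int[mu]_x f (x + a)%R = \int[mu]_x f x)%E.
Proof.
apply: (@integral_lebesgueT (fun x => x + a)).
  exact: measurable_funD.
move=> _ [[u v]] _ <-; rewrite /pushforward.
rewrite (_ : _ @^-1` _ = `]u - a, v - a]%classic).
  rewrite !lebesgue_measure_itv/= !lte_fin ltrD2r.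
  by case: ifP => // _; congr (_%:E); ring.
by apply/seteqP; split => x /=; rewrite !in_itv/= ltrBlDr lerBrDr.
Qed.

Lemma integral_lebesgueN f :
  measurable_fun [set: measurableTypeR R] f -> (forall x, 0 <= f x)%E ->
  (\int[mu]_x f (- x)%R = \int[mu]_x f x)%E.
Proof.
apply: (@integral_lebesgueT (fun x => - x)); first exact: oppr_measurable.
by move=> _ [[u v]] _ <-; rewrite lebesgue_measureN.
Qed.

Lemma normal_pdfN (x : R) : pdf (- x) = pdf x.
Proof. by rewrite !normal_pdfE ?oner_eq0// /normal_fun !subr0 sqrrN. Qed.

Lemma integral_normalN f :
  measurable_fun [set: measurableTypeR R] f -> (forall x, 0 <= f x)%E ->
  (\int[gam]_x f (- x)%R = \int[gam]_x f x)%E.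
Proof.
move=> mf f0; have mpdf := measurable_normal_pdf (0 : R) 1.
rewrite !integral_normal//; last by apply: measurableT_comp.
rewrite -[RHS]integral_lebesgueN/=.
- by apply: eq_integral => x _; rewrite normal_pdfN.
- by apply: emeasurable_funM => //; exact/measurable_EFinP.
- by move=> x; rewrite mule_ge0// lee_fin normal_pdf_ge0.
Qed.

Notation T2 := (measurableTypeR R * measurableTypeR R)%type.

Let mfun2 (F : R -> R -> \bar R) := measurable_fun [set: T2] (fun x : T2 => F x.1 x.2).
Let int2 (m : {measure set (measurableTypeR R) -> \bar R}) (F : R -> R -> \bar R) :=
  (\int[m]_t \int[m]_s F s t)%E.

Let mfun2_lin (a b c d : R) F : mfun2 F ->
  mfun2 (fun s t => F (a * s + b * t) (c * s + d * t)).
Proof.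
have mlin (u v : R) : measurable_fun [set: T2]
    ((fun x => u * x.1 + v * x.2) : T2 -> measurableTypeR R).
  by apply: measurable_funD; apply: measurable_funM.
move=> mF; exact: (measurableT_comp mF (measurable_fun_pair (mlin a b) (mlin c d))).
Qed.

Let mfun2_1 F t : mfun2 F -> measurable_fun [set: measurableTypeR R] (F ^~ t).
Proof. by move=> mF; exact: (measurableT_comp mF (pair2_measurable t)). Qed.

Let mfun2_2 F s : mfun2 F -> measurable_fun [set: measurableTypeR R] (F s).
Proof. by move=> mF; exact: (measurableT_comp mF (pair1_measurable s)). Qed.

Let int2_shear1 (a : R) F : mfun2 F -> (forall s t, 0 <= F s t)%E ->
  int2 mu (fun s t => F (1 * s + a * t) (0 * s + 1 * t))%R = int2 mu F.
Proof.
move=> mF F0; apply: eq_integral => t _.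
rewrite -[RHS](@integral_lebesgueD (a * t) (F ^~ t))//; last exact: mfun2_1.
by apply: eq_integral => s _; rewrite !mul1r mul0r add0r.
Qed.

Let int2C F : mfun2 F -> (forall s t, 0 <= F s t)%E ->
  int2 mu F = (\int[mu]_s \int[mu]_t F s t)%E.
Proof.
move=> mF F0; apply: esym.
exact: (@fubini_tonelli _ _ _ _ _ mu mu (fun x => F x.1 x.2) mF (fun x => F0 x.1 x.2)).
Qed.

Let int2_shear2 (a : R) F : mfun2 F -> (forall s t, 0 <= F s t)%E ->
  int2 mu (fun s t => F (1 * s + 0 * t) (a * s + 1 * t))%R = int2 mu F.
Proof.
move=> mF F0; apply: etrans (etrans _ (esym (int2C mF F0))).
  by apply: int2C; [exact: (mfun2_lin 1 0 a 1 mF)|move=> s t; exact: F0].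
apply: eq_integral => s _.
rewrite -[RHS](@integral_lebesgueD (a * s) (F s))//; last exact: mfun2_2.
by apply: eq_integral => t _; rewrite !mul1r mul0r addr0 addrC.
Qed.

(* A rotation is a product of three shears, each of which preserves the
   Lebesgue measure of the plane by Fubini and translation invariance. *)
Let int2_rot (c d : R) F : c ^+ 2 + d ^+ 2 = 1 -> d != 0 ->
  mfun2 F -> (forall s t, 0 <= F s t)%E ->
  int2 mu (fun s t => F (c * s + - d * t) (d * s + c * t))%R = int2 mu F.
Proof.
(* The shears with slopes [a], [d], [a] multiply to a matrix with diagonal entries [1 + a * d = c]
   and upper right entry [a * (1 + c) = - d]. *)
move=> cd d0 mF F0; pose a := (c - 1) / d.
have m1 : mfun2 (fun s t => F (1 * s + a * t) (0 * s + 1 * t)) by exact: mfun2_lin.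
have m2 := mfun2_lin 1 0 d 1 m1.
apply: etrans (int2_shear1 a mF F0).
apply: etrans (int2_shear2 d m1 (fun s t => F0 _ _)).
apply: etrans (int2_shear1 a m2 (fun s t => F0 _ _)).
congr int2; apply/funext => s; apply/funext => t; congr F; last by rewrite /a; field.
apply: (mulIf d0); rewrite /a.
rewrite [RHS](_ : _ = c * d * s + (c ^+ 2 - 1) * t); last by field.
by rewrite -cd; ring.
Qed.

Let pdf0 x : (0 <= (pdf x)%:E)%E.
Proof. by rewrite lee_fin normal_pdf_ge0. Qed.

Let mfun2_pdf1 : mfun2 (fun s t => (pdf s)%:E).
Proof.
apply/measurable_EFinP.
exact: (measurableT_comp (measurable_normal_pdf (0 : R) 1) measurable_fst).
Qed.

Let mfun2_pdf2 : mfun2 (fun s t => (pdf t)%:E).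
Proof.
apply/measurable_EFinP.
exact: (measurableT_comp (measurable_normal_pdf (0 : R) 1) measurable_snd).
Qed.

Let int2_normal F : mfun2 F -> (forall s t, 0 <= F s t)%E ->
  int2 gam F = int2 mu (fun s t => F s t * (pdf s)%:E * (pdf t)%:E)%E.
Proof.
move=> mF F0.
have mG : mfun2 (fun s t => F s t * (pdf s)%:E)%E by apply: emeasurable_funM.
have G0 s t : (0 <= F s t * (pdf s)%:E)%E by rewrite mule_ge0.
rewrite /int2.
rewrite (_ : (fun t => \int[gam]_s F s t)%E =
    (fun t => \int[mu]_s (F s t * (pdf s)%:E))%E); last first.
  apply/funext => t; apply: integral_normal => //; exact: mfun2_1.
rewrite integral_normal; last 2 first.
- exact: (@measurable_fun_fubini_tonelli_G _ _ _ _ _ mu (fun x => F x.1 x.2 * (pdf x.1)%:E)%E mG (fun x => G0 x.1 x.2)).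
- by move=> t; apply: integral_ge0 => s _.
apply: eq_integral => t _; rewrite -ge0_integralZr//.
exact: (mfun2_1 t mG).
Qed.

(** The product of the two densities depends on [s ^+ 2 + t ^+ 2] only, so the rotation invariance
    of Lebesgue measure passes to the Gaussian measure. *)
Let normal2_rot0 (c d : R) F : c ^+ 2 + d ^+ 2 = 1 -> d != 0 ->
  mfun2 F -> (forall s t, 0 <= F s t)%E ->
  int2 gam (fun s t => F (c * s + - d * t) (d * s + c * t))%R = int2 gam F.
Proof.
move=> cd d0 mF F0.
have mG : mfun2 (fun s t => F s t * (pdf s)%:E * (pdf t)%:E)%E.
  by apply: emeasurable_funM => //; apply: emeasurable_funM.
have G0 s t : (0 <= F s t * (pdf s)%:E * (pdf t)%:E)%E by rewrite !mule_ge0.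
apply: etrans (int2_normal (mfun2_lin c (- d) d c mF) (fun s t => F0 _ _)) _.
apply: etrans (esym (int2_normal mF F0)).
apply: etrans (int2_rot cd d0 mG G0).
congr int2; apply/funext => s; apply/funext => t.
rewrite -!muleA; congr (_ * _)%E.
rewrite -!EFinM; congr EFin; rewrite !normal_pdfE ?oner_eq0//.
rewrite /normal_fun !subr0 mulrACA [RHS]mulrACA -!expRD; congr (_ * expR _).
rewrite -!mulrDl; congr (_ / _).
rewrite -!opprD; congr (- _).
by rewrite -[LHS]mul1r -cd; ring.
Qed.

Lemma normal2_rot (c d : R) (F : R -> R -> \bar R) : c ^+ 2 + d ^+ 2 = 1 ->
  measurable_fun [set: T2] (fun x : T2 => F x.1 x.2) ->
  (forall s t, 0 <= F s t)%E ->
  (\int[gam]_t \int[gam]_s F (c * s - d * t)%R (d * s + c * t)%R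
   = \int[gam]_t \int[gam]_s F s t)%E.
Proof.
move=> cd mF F0; rewrite -/(int2 gam F).
have [d0|d0] := eqVneq d 0; last first.
  rewrite -(normal2_rot0 cd d0 mF F0); apply: eq_integral => t _.
  by apply: eq_integral => s _; rewrite mulNr.
have q1 : 0 ^+ 2 + 1 ^+ 2 = 1 :> R by rewrite expr0n expr1n add0r.
have [c1|c1] : c = 1 \/ c = -1.
- have : (c - 1) * (c + 1) = 0 by move: cd; rewrite d0; lra.
  by move/eqP; rewrite mulf_eq0 => /orP[]/eqP ?; [left|right]; lra.
- by apply: eq_integral => t _; apply: eq_integral => s _; congr F; rewrite c1 d0; ring.
(* The case [c = -1], [d = 0] is a half turn, on which the shear factorisation breaks down; it is
   the square of a quarter turn, where [d = 1]. *)
have m1 := mfun2_lin 0 (- 1) 1 0 mF.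
apply: etrans (normal2_rot0 q1 (oner_neq0 _) mF F0).
apply: etrans (normal2_rot0 q1 (oner_neq0 _) m1 (fun s t => F0 _ _)).
by apply: eq_integral => t _; apply: eq_integral => s _; congr F; rewrite c1 d0 /=; ring.
Qed.

Lemma integral_normal_sqr_fin_num : (\int[gam]_x (x ^+ 2)%:E)%E \is a fin_num.
Proof.
have mpdf := measurable_normal_pdf (0 : R) 1.
have msq : measurable_fun [set: measurableTypeR R] (fun x : measurableTypeR R => (x ^+ 2)%:E).
  exact/measurable_EFinP/measurable_funX.
rewrite ge0_fin_numE; last by apply: integral_ge0 => x _; rewrite lee_fin sqr_ge0.
rewrite integral_normal//; last by move=> x; rewrite lee_fin sqr_ge0.
(* Since [x ^+ 2 <= 4 * expR (x ^+ 2 / 4)], the integrand is at most a multiple of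
   [expR (- x ^+ 2 / 4)], which is a multiple of the Gaussian density of variance 2. *)
pose s := Num.sqrt (2 : R).
have s2 : s ^+ 2 = 2 by rewrite sqr_sqrtr.
have s0 : s != 0 by rewrite gt_eqF// sqrtr_gt0.
pose C := 4 * normal_peak (1 : R) / normal_peak s.
have C0 : 0 <= C by rewrite !mulr_ge0 ?invr_ge0 ?normal_peak_ge0.
apply: (@le_lt_trans _ _ (\int[mu]_x (C%:E * (normal_pdf 0 s x)%:E))%E).
  apply: ge0_le_integral => //=.
  - by move=> x _; rewrite mule_ge0// lee_fin ?sqr_ge0 ?normal_pdf_ge0.
  - by apply: emeasurable_funM => //; exact/measurable_EFinP.
  - by apply: emeasurable_funM => //; apply/measurable_EFinP; exact: measurable_normal_pdf.
  - move=> x _; rewrite -!EFinM lee_fin !normal_pdfE ?oner_eq0//.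
    rewrite /C /normal_fun !subr0 s2 expr1n.
    rewrite [leRHS](_ : _ = normal_peak 1 * (4 * expR (- x ^+ 2 / (2 *+ 2)))); last first.
      by field; rewrite gt_eqF// normal_peak_gt0.
    rewrite mulrCA ler_wpM2l ?normal_peak_ge0//.
    have -> : - x ^+ 2 / (2 *+ 2) = x ^+ 2 / 4 + - x ^+ 2 / 2 by field.
    rewrite expRD mulrA ler_wpM2r ?expR_ge0//.
    by have := expR_ge1Dx (x ^+ 2 / 4); lra.
rewrite ge0_integralZl//=; last 2 first.
- by apply/measurable_EFinP; exact: measurable_normal_pdf.
- by move=> x _; rewrite lee_fin normal_pdf_ge0.
by rewrite integral_normal_pdf mule1 ltry.
Qed.

(** The second moment of a standard Gaussian, kept as a symbolic positive constant: its square root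
    relates operator norms to Gaussian norms. *)
Definition normal_sqr : R := fine (\int[gam]_x (x ^+ 2)%:E).

(** A zero second moment would concentrate the Gaussian measure at 0, but it has no atoms. *)
Lemma normal_sqr_gt0 : 0 < normal_sqr.
Proof.
rewrite fine_gt0//; apply/andP; split; last first.
  by rewrite -ge0_fin_numE ?integral_normal_sqr_fin_num//; apply: integral_ge0 => x _; rewrite lee_fin sqr_ge0.
rewrite lt0e; apply/andP; split; last by apply: integral_ge0 => x _; rewrite lee_fin sqr_ge0.
apply/eqP => i0.
have msq : measurable_fun [set: measurableTypeR R] (fun x : measurableTypeR R => (x ^+ 2)%:E).
  exact/measurable_EFinP/measurable_funX.
have : (\int[gam]_x `|(x ^+ 2)%:E| = 0)%E.
  by rewrite -[RHS]i0; apply: eq_integral => x _; rewrite gee0_abs// lee_fin sqr_ge0.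
move/(ae_eq_integral_abs _ measurableT msq) => N0.
have : (gam [set: measurableTypeR R] <= gam [set (0%R : R)])%E.
  have [N [mN N00 NE]] := N0.
  rewrite -[leRHS]adde0 -N00.
  apply: (@le_trans _ _ (gam ([set (0%R : R)] `|` N))).
    apply: le_measure; rewrite ?inE//; first exact: measurableU.
    move=> x _; have [->|x0] := eqVneq x 0; [by left|right; apply: NE => /= /(_ I) [] /eqP].
    by rewrite sqrf_eq0 (negbTE x0).
  exact: measureU2.
rewrite probability_setT /normal_prob integral_set1.
by rewrite leNgt lte01.
Qed.

End normal_integral.

(** * Iterated Gaussian integrals and isometries *)

Section gauss_int.
Context {R : realType}.
Implicit Types (n : nat) (F G : (nat -> R) -> \bar R) (v : nat -> R).
Notation gam := (normal_prob (0 : R) 1).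

Definition upd n (t : R) v : nat -> R := fun i => if i == n then t else v i.

(* Measurability with respect to the product sigma-algebra on [nat -> R], and
   on [A * (nat -> R)], expressed by testing against measurable families. *)
Definition fmeas F := forall d (B : measurableType d) (f : nat -> B -> measurableTypeR R),
  (forall i, measurable_fun setT (f i)) -> measurable_fun setT (fun b => F (f ^~ b)).

Definition pmeas d (A : measurableType d) (K : A -> (nat -> R) -> \bar R) :=
  forall d' (B : measurableType d') (p : B -> A) (f : nat -> B -> measurableTypeR R),
  measurable_fun setT p -> (forall i, measurable_fun setT (f i)) ->
  measurable_fun setT (fun b => K (p b) (f ^~ b)).

Lemma pmeas_fmeas d (A : measurableType d) (K : A -> (nat -> R) -> \bar R) a :
  pmeas K -> fmeas (K a).
Proof. by move=> mK d' B f mf; apply: (mK _ _ (fun=> a)). Qed.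

Lemma pmeas_upd d (A : measurableType d) (K : A -> (nat -> R) -> \bar R) n :
  pmeas K ->
  pmeas (fun (a : A * measurableTypeR R) v => K a.1 (upd n a.2 v)).
Proof.
move=> mK d' B p f mp mf.
apply: (mK _ _ (fun b => (p b).1) (fun i b => if i == n then (p b).2 else f i b)).
  exact: measurableT_comp.
by move=> i; case: (i == n) => //; exact: measurableT_comp.
Qed.

Lemma fmeas_upd F n :
  fmeas F -> pmeas (fun (t : measurableTypeR R) v => F (upd n t v)).
Proof.
move=> mF d' B p f mp mf; apply: (mF _ _ (fun i b => if i == n then p b else f i b)).
by move=> i; case: (i == n).
Qed.

Lemma gauss_int_ge0 n F : (forall v, 0 <= F v)%E -> (0 <= gauss_int n F)%E.
Proof.
elim: n F => [|n IH] F F0 /=; first exact: F0.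
by apply: integral_ge0 => t _; apply: IH.
Qed.

(** The parameter space [A] is arbitrary so that the induction can absorb the next coordinate into
    it, as [A * R], and apply Tonelli. *)
Lemma measurable_gauss_int n d (A : measurableType d) (K : A -> (nat -> R) -> \bar R) :
  pmeas K -> (forall a v, 0 <= K a v)%E ->
  measurable_fun setT (fun a => gauss_int n (K a)).
Proof.
elim: n d A K => [|n IH] d A K mK K0 /=.
  by apply: (mK _ _ id (fun _ _ => 0)).
exact: (@measurable_fun_fubini_tonelli_F _ _ _ _ _ gam _ (IH _ _ _ (pmeas_upd n mK) (fun b v => K0 _ _)) (fun b => gauss_int_ge0 _ (fun v => K0 _ _))).
Qed.

Lemma measurable_gauss_int1 n F : fmeas F -> (forall v, 0 <= F v)%E ->
  measurable_fun [set: measurableTypeR R] (fun t => gauss_int n (fun v => F (upd n t v))).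
Proof.
by move=> mF F0; apply: measurable_gauss_int => //; exact: fmeas_upd.
Qed.

Lemma le_gauss_int n F G : fmeas F -> fmeas G -> (forall v, 0 <= F v)%E ->
  (forall v, F v <= G v)%E -> (gauss_int n F <= gauss_int n G)%E.
Proof.
elim: n F G => [|n IH] F G mF mG F0 FG /=; first exact: FG.
have G0 v : (0 <= G v)%E by exact: le_trans (FG v).
apply: ge0_le_integral => //.
- by move=> t _; exact: gauss_int_ge0.
- exact: measurable_gauss_int1.
- exact: measurable_gauss_int1.
- move=> t _; apply: IH => //; exact: (pmeas_fmeas t (fmeas_upd n _)).
Qed.

Lemma gauss_intD n F G : fmeas F -> fmeas G -> (forall v, 0 <= F v)%E ->
  (forall v, 0 <= G v)%E ->
  (gauss_int n (fun v => F v + G v) = gauss_int n F + gauss_int n G)%E.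
Proof.
elim: n F G => [//|n IH] F G mF mG F0 G0 /=.
rewrite -ge0_integralD//.
- apply: eq_integral => t _; apply: IH => //; exact: (pmeas_fmeas t (fmeas_upd n _)).
- by move=> t _; exact: gauss_int_ge0.
- exact: measurable_gauss_int1.
- by move=> t _; exact: gauss_int_ge0.
- exact: measurable_gauss_int1.
Qed.

Lemma gauss_intZ n F (k : R) : fmeas F -> (forall v, 0 <= F v)%E -> 0 <= k ->
  (gauss_int n (fun v => k%:E * F v) = k%:E * gauss_int n F)%E.
Proof.
move=> + + k0; elim: n F => [//|n IH] F mF F0 /=.
rewrite -ge0_integralZl//.
- apply: eq_integral => t _; apply: IH => //; exact: (pmeas_fmeas t (fmeas_upd n _)).
- exact: measurable_gauss_int1.
- by move=> t _; exact: gauss_int_ge0.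
Qed.

Lemma gauss_int_cst n (c : \bar R) : gauss_int n (fun=> c) = c.
Proof.
elim: n => [//|n IH] /=; rewrite (_ : (fun t => _) = cst c) ?integral_cst//.
  exact: etrans (congr1 _ (@probability_setT _ _ R gam)) (mule1 c).
by apply/funext => t; rewrite IH.
Qed.

Lemma eq_gauss_int n F G : F =1 G -> gauss_int n F = gauss_int n G.
Proof. by move/funext => ->. Qed.

Definition givens k (c d : R) v : nat -> R := fun i =>
  if i == k then c * v k - d * v k.+1 else
  if i == k.+1 then d * v k + c * v k.+1 else v i.

(** Rotations act on adjacent coordinates because [gauss_int] integrates coordinate by coordinate:
    once the outer integrals are peeled off, coordinates [k] and [k.+1] are the two outermost ones
    and the planar statement applies. *)
Lemma gauss_int_rot n k c d F : (k.+1 < n)%N -> c ^+ 2 + d ^+ 2 = 1 ->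
  fmeas F -> (forall v, 0 <= F v)%E ->
  gauss_int n (fun v => F (givens k c d v)) = gauss_int n F.
Proof.
elim: n F => [//|n IH] F kn cd mF F0.
move: kn; rewrite ltnS leq_eqVlt => /orP[/eqP <-|kn]; last first.
  apply: eq_integral => t _.
  rewrite -[RHS]IH//; last exact: (pmeas_fmeas t (fmeas_upd n _)).
  apply: eq_gauss_int => v; congr F; apply/funext => i; rewrite /givens /upd.
  rewrite (ltn_eqF kn) (ltn_eqF (ltnW kn)).
  have [->|//] := eqVneq i n.
  by rewrite (gtn_eqF kn) (gtn_eqF (ltnW kn)).
have mP : pmeas (fun (x : measurableTypeR R * measurableTypeR R) v =>
    F (upd k.+1 x.2 (upd k x.1 v))).
  move=> d' B p f mp mf.
  apply: (mF _ _ (fun i b => if i == k.+1 then (p b).2 else if i == k then (p b).1 else f i b)).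
  by move=> i; case: (i == k.+1); [|case: (i == k)] => //; exact: measurableT_comp.
apply: etrans (@normal2_rot R c d
  (fun s t => gauss_int k (fun v => F (upd k.+1 t (upd k s v)))) cd
  (measurable_gauss_int k mP (fun x v => F0 _))
  (fun s t => gauss_int_ge0 _ (fun v => F0 _))).
apply: eq_integral => t _; apply: eq_integral => s _; apply: eq_gauss_int => v.
congr F; apply/funext => i; rewrite /givens /upd.
rewrite !eqxx (ltn_eqF (ltnSn k)).
by have [->|] := eqVneq i k; rewrite ?(ltn_eqF (ltnSn k))//; case: (i == k.+1).
Qed.

(** The transpose of the [M] by [N] matrix [W] acting on sequences. The value 0 from [N] on agrees
    with the zero sequence at which [gauss_int] starts. *)
Definition lin M N (W : nat -> nat -> R) v : nat -> R := fun j =>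
  if (j < N)%N then \sum_(i < M) W i j * v i else 0.

Lemma fmeas_lin M N W F : fmeas F -> fmeas (fun v => F (lin M N W v)).
Proof.
move=> mF d B f mf.
apply: (mF _ _ (fun j b => if (j < N)%N then \sum_(i < M) W i j * f i b else 0)).
move=> j; case: (j < N)%N => //; apply: measurable_sum => i.
by apply: measurable_funM => //; exact: mf.
Qed.

Lemma sum_two M k (f : nat -> R) : (k.+1 < M)%N ->
  \sum_(i < M) f i = f k + f k.+1 + \sum_(i < M | (i != k :> nat) && (i != k.+1 :> nat)) f i.
Proof.
move=> kM; have kM' := ltnW kM.
rewrite (bigD1 (Ordinal kM'))//= -addrA; congr (_ + _).
rewrite (bigD1 (Ordinal kM))/=; last by rewrite -val_eqE/= gtn_eqF.
by congr (_ + _); apply: eq_bigl => i; rewrite -!val_eqE.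
Qed.

Lemma sum_rot M k c d (u v : nat -> R) : (k.+1 < M)%N ->
  \sum_(i < M) u i * givens k c d v i = \sum_(i < M) givens k c (- d) u i * v i.
Proof.
move=> kM; rewrite (sum_two (fun i => u i * givens k c d v i) kM).
rewrite (sum_two (fun i => givens k c (- d) u i * v i) kM); congr (_ + _).
  by rewrite /givens !eqxx (gtn_eqF (ltnSn k)); ring.
by apply: eq_bigr => i /andP[ik ik1]; rewrite /givens (negbTE ik) (negbTE ik1).
Qed.

Lemma sum_rot2 M k c d (u v : nat -> R) : (k.+1 < M)%N -> c ^+ 2 + d ^+ 2 = 1 ->
  \sum_(i < M) givens k c d u i * givens k c d v i = \sum_(i < M) u i * v i.
Proof.
move=> kM cd; rewrite sum_rot//; apply: eq_bigr => i _; congr (_ * _).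
rewrite /givens !eqxx (gtn_eqF (ltnSn k)).
have [->|_] := eqVneq (i : nat) k.
  by rewrite -[RHS]mul1r -cd; ring.
have [->|//] := eqVneq (i : nat) k.+1.
by rewrite -[RHS]mul1r -cd; ring.
Qed.

(* Givens rotations in the planes (k, k+1) clear the first entries of a column. *)
Lemma gauss_int_lin_reduce M N (W : nat -> nat -> R) c k : (k <= M)%N -> exists W',
  [/\ forall F, fmeas F -> (forall v, 0 <= F v)%E ->
        gauss_int M.+1 (fun v => F (lin M.+1 N W v)) =
        gauss_int M.+1 (fun v => F (lin M.+1 N W' v)),
      forall j l, \sum_(i < M.+1) W' i j * W' i l = \sum_(i < M.+1) W i j * W i l &
      forall i, (i < k)%N -> W' i c = 0].
Proof.
elim: k => [_|k IH kM]; first by exists W.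
have [W' [W1 W2 W3]] := IH (ltnW kM).
pose r2 := W' k c ^+ 2 + W' k.+1 c ^+ 2.
have [r0|r0] := eqVneq r2 0.
  exists W'; split => // i; rewrite ltnS leq_eqVlt => /orP[/eqP ->|]; last exact: W3.
  move/eqP: r0; rewrite paddr_eq0 ?sqr_ge0// => /andP[+ _].
  by rewrite sqrf_eq0 => /eqP.
have rgt0 : 0 < r2 by rewrite lt_neqAle eq_sym r0 addr_ge0 ?sqr_ge0.
pose r := Num.sqrt r2.
have r_neq0 : r != 0 by rewrite gt_eqF// sqrtr_gt0.
have rr : r ^+ 2 = r2 by rewrite sqr_sqrtr ?ltW.
(* This rotation carries the pair of entries [W' k c], [W' k.+1 c] to [0], [r]; the rows before [k],
   already cleared, are untouched. *)
pose C := W' k.+1 c / r; pose D := - (W' k c / r).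
have CD : C ^+ 2 + D ^+ 2 = 1.
  rewrite /C /D sqrrN !expr_div_n -mulrDl addrC -/r2 rr mulfV//.
exists (fun i j => givens k C (- D) (W' ^~ j) i); split.
- move=> F mF F0; rewrite W1// -(gauss_int_rot (k := k) _ CD)//; last exact: fmeas_lin.
  apply: eq_gauss_int => v; congr F; apply/funext => j; rewrite /lin; case: ifP => // _.
  by rewrite (sum_rot C D (W' ^~ j)).
- by move=> j l; rewrite -W2 (sum_rot2 (W' ^~ j) (W' ^~ l))// sqrrN.
- move=> i; rewrite ltnS leq_eqVlt => /orP[/eqP ->|ik]; rewrite /givens.
    by rewrite eqxx /C /D; field.
  by rewrite (ltn_eqF ik) (ltn_eqF (ltnW ik : (i < k.+1)%N)) W3.
Qed.

(** Induction on the columns. Once column [N] is cleared above its last row, orthonormality makes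
    the remaining entry 1 or -1 and forces the rest of the last row to vanish. The last Gaussian
    then splits off, its sign absorbed by symmetry. *)
Lemma gauss_int_isometry N M (W : nat -> nat -> R) F :
  (forall j l, (j < N)%N -> (l < N)%N -> \sum_(i < M) W i j * W i l = (j == l)%:R) ->
  fmeas F -> (forall v, 0 <= F v)%E ->
  gauss_int M (fun v => F (lin M N W v)) = gauss_int N F.
Proof.
elim: N M W F => [|N IH] M W F Wiso mF F0.
  rewrite (_ : (fun v => _) = (fun=> F (fun=> 0))) ?gauss_int_cst//.
case: M Wiso => [|M] Wiso.
  have := Wiso N N (leqnn _) (leqnn _); rewrite big_ord0 eqxx => /esym/eqP.
  by rewrite oner_eq0.
have [W' [W1 W2 W3]] := gauss_int_lin_reduce N.+1 W N (leqnn M).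
rewrite W1//.
have wN j : (j <= N)%N -> W' M j * W' M N = (j == N)%:R.
  move=> jN; rewrite -(Wiso j N)// -W2 big_ord_recr/= big1 ?add0r// => i _.
  by rewrite W3// mulr0.
have wNN : W' M N = 1 \/ W' M N = -1.
  have := wN N (leqnn _); rewrite eqxx mulr1n => w2.
  have : (W' M N - 1) * (W' M N + 1) = 0 by lra.
  by move/eqP; rewrite mulf_eq0 => /orP[]/eqP ?; [left|right]; lra.
have w0 j : (j < N)%N -> W' M j = 0.
  move=> jN; have := wN j (ltnW jN); rewrite (ltn_eqF jN).
  by case: wNN => ->; rewrite ?mulrN mulr1 => /eqP; rewrite ?oppr_eq0 => /eqP.
transitivity (\int[gam]_s gauss_int N (fun v => F (upd N (W' M N * s)%R v)))%E; last first.
  case: wNN => ->; first by apply: eq_integral => t _; rewrite mul1r.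
  rewrite /= -[RHS]integral_normalN; first by apply: eq_integral => t _; rewrite mulN1r.
    exact: measurable_gauss_int1.
  by move=> t; exact: gauss_int_ge0.
apply: eq_integral => s _.
rewrite -(IH M W'); last 3 first.
- move=> j l jN lN; rewrite -(Wiso j l (ltnW jN) (ltnW lN)) -W2 big_ord_recr/=.
  by rewrite w0// mul0r addr0.
- exact: (pmeas_fmeas _ (fmeas_upd N mF)).
- by [].
apply: eq_gauss_int => v; congr F; apply/funext => j; rewrite /lin /upd.
rewrite big_ord_recr/= eqxx.
have E : \sum_(i < M) W' i j * (if (i : nat) == M then s else v i) = \sum_(i < M) W' i j * v i.
  by apply: eq_bigr => i _; rewrite (ltn_eqF (ltn_ord i)).
rewrite E; have [->|jN] := eqVneq j N.
  by rewrite ltnSn big1 ?add0r// => i _; rewrite W3// mul0r.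
rewrite ltnS leq_eqVlt (negbTE jN)/=; case: ifP => // jN'.
by rewrite w0// mul0r addr0.
Qed.

End gauss_int.

(** * Gaussian sums in a normed space *)

(** The discriminant of a nonnegative quadratic polynomial; every Cauchy-Schwarz inequality below
    comes from it, also for degenerate forms ([c = 0]). *)
Lemma discr_le {R : realType} (a b c : R) :
  (forall t, 0 <= a + 2 * t * b + t ^+ 2 * c) -> 0 <= c -> b ^+ 2 <= a * c.
Proof.
move=> h c0; have [c0'|c0'] := eqVneq c 0; last first.
  have := h (- b / c).
  have -> : a + 2 * (- b / c) * b + (- b / c) ^+ 2 * c = (a * c - b ^+ 2) / c by field.
  by rewrite pmulr_lge0 ?subr_ge0// invr_gt0 lt_neqAle eq_sym c0' c0.
rewrite c0' mulr0; have [->|b0] := eqVneq b 0; first by rewrite expr0n.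
have := h (- (a + 1) / (2 * b)); rewrite c0' mulr0 addr0.
have -> : a + 2 * (- (a + 1) / (2 * b)) * b = - 1 by field.
by lra.
Qed.

(** * Completing a contraction matrix to an isometry *)

Section contraction_completion.
Context {R : realType}.
Variables (N : nat).
Implicit Types (a b : nat -> R) (W : nat -> nat -> R).

Let dot a b := \sum_(j < N) a j * b j.
(** The defect form of the first [M] rows, that is, the identity minus the Gram matrix of the
    columns: positive semidefinite for a contraction, zero for an isometry. *)
Let Q M W a b := dot a b - \sum_(i < M) dot (W i) a * dot (W i) b.
Let e k : nat -> R := fun j => (j == k)%:R.

Let dotC a b : dot a b = dot b a.
Proof. by apply: eq_bigr => i _; rewrite mulrC. Qed.

Let dotD t a b c : dot c (fun j => a j + t * b j) = dot c a + t * dot c b.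
Proof. by rewrite /dot mulr_sumr -big_split; apply: eq_bigr => i _ /=; ring. Qed.

Let dote k a : (k < N)%N -> dot a (e k) = a k.
Proof.
move=> kN; rewrite /dot (bigD1 (Ordinal kN))//= big1 ?addr0 /e ?eqxx ?mulr1//.
by move=> i; rewrite -val_eqE/= => /negbTE ->; rewrite mulr0.
Qed.

Let QC M W a b : Q M W a b = Q M W b a.
Proof. by rewrite /Q dotC; congr (_ - _); apply: eq_bigr => i _; rewrite mulrC. Qed.

Let QD M W t a b c : Q M W c (fun j => a j + t * b j) = Q M W c a + t * Q M W c b.
Proof.
rewrite /Q dotD.
under eq_bigr do rewrite dotD mulrDr mulrCA.
by rewrite big_split/= -mulr_sumr; ring.
Qed.

Let Q_CS M W a b : (forall a, 0 <= Q M W a a) -> Q M W a b ^+ 2 <= Q M W a a * Q M W b b.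
Proof.
move=> Q0; apply: discr_le => // t.
pose c j := a j + t * b j.
have Ea : Q M W c a = Q M W a a + t * Q M W a b by rewrite QC QD.
have Eb : Q M W c b = Q M W a b + t * Q M W b b by rewrite QC QD (QC _ _ b a).
have := Q0 c; rewrite {2}/c QD Ea Eb; congr (_ <= _); ring.
Qed.

(* Rows are added one at a time: the k-th new row cancels the k-th row of the
   positive semidefinite defect form, as in the Cholesky algorithm. *)
Lemma contraction_completion M W : (forall a, \sum_(i < M) dot (W i) a ^+ 2 <= dot a a) ->
  exists W', (forall i, (i < M)%N -> W' i = W i) /\
  forall j l, (j < N)%N -> (l < N)%N -> \sum_(i < M + N) W' i j * W' i l = (j == l)%:R.
Proof.
move=> Wc.
suff H k : (k <= N)%N -> exists W', [/\ forall i, (i < M)%N -> W' i = W i,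
    forall a, 0 <= Q (M + k) W' a a &
    forall j a, (j < k)%N -> Q (M + k) W' a (e j) = 0].
  have [W' [W1 _ W3]] := H N (leqnn N); exists W'; split => // j l jN lN.
  have := W3 l (e j) lN; rewrite /Q dote//.
  under eq_bigr do rewrite !dote//.
  by move/eqP; rewrite subr_eq0 => /eqP <-; rewrite /e eq_sym.
elim: k => [_|k IH kN].
  exists W; split => // a; rewrite addn0 /Q subr_ge0.
  by under eq_bigr do rewrite -expr2; exact: Wc.
have [W' [W1 W2 W3]] := IH (ltnW kN).
pose q := Q (M + k) W' (e k) (e k).
(* Row [k] of the defect form over the square root of its pivot. For [q = 0] division by zero makes
   [w] vanish, which is right: Cauchy-Schwarz for the form then makes row [k] zero already. *)
pose w j := Q (M + k) W' (e j) (e k) / Num.sqrt q.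
pose W'' i := if i == (M + k)%N then w else W' i.
have WE i : (i < M + k)%N -> W'' i = W' i by move=> ik; rewrite /W'' (ltn_eqF ik).
have dotw a : dot w a = Q (M + k) W' a (e k) / Num.sqrt q.
  transitivity (Q (M + k) W' (e k) a / Num.sqrt q); last by rewrite QC.
  have -> : Q (M + k) W' (e k) a = \sum_(j < N) Q (M + k) W' (e k) (e j) * a j.
    under eq_bigr do rewrite /Q dote// mulrBl.
    rewrite /Q sumrB; congr (_ - _).
    under [RHS]eq_bigr do rewrite mulr_suml.
    rewrite exchange_big/=; apply: eq_bigr => i _; rewrite [X in _ * X]/dot mulr_sumr.
    by apply: eq_bigr => j _; rewrite [in RHS](dote (W' i) (ltn_ord j)) mulrA.
  by rewrite mulr_suml; apply: eq_bigr => j _; rewrite /w (QC _ _ _ (e k)); ring.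
have QE a b : Q (M + k.+1) W'' a b = Q (M + k) W' a b - dot w a * dot w b.
  rewrite /Q addnS big_ord_recr/= {3 4}/W'' eqxx opprD addrA; congr (_ - _ - _).
  by apply: eq_bigr => i _; rewrite WE.
have q0 : 0 <= q by exact: W2.
have Qk0 : q = 0 -> forall a, Q (M + k) W' a (e k) = 0.
  move=> qE a; apply/eqP; rewrite -sqrf_eq0 eq_le sqr_ge0 andbT.
  by have := Q_CS a (e k) W2; rewrite -/q qE mulr0.
exists W''; split.
- by move=> i iM; rewrite WE ?W1// ltn_addr.
- move=> a; rewrite QE dotw.
  have := Q_CS a (e k) W2; rewrite -/q => CS.
  have [qE|qN] := eqVneq q 0; first by rewrite Qk0// mul0r mul0r subr0.
  rewrite -expr2 expr_div_n sqr_sqrtr// subr_ge0 ler_pdivrMr// lt_neqAle eq_sym qN//.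
- move=> j a; rewrite ltnS leq_eqVlt QE !dotw => /orP[/eqP ->|jk]; last first.
    by rewrite (W3 j a jk) (QC _ _ (e j)) (W3 j _ jk) mul0r mulr0 subr0.
  have [qE|qN] := eqVneq q 0; first by rewrite Qk0// mul0r mul0r subr0.
  rewrite -/q mulf_div -expr2 sqr_sqrtr// mulfK// subrr//.
Qed.

End contraction_completion.

Section gauss_sq.
Context {R : realType} {E : normedModType R}.
Implicit Types (x y : nat -> E) (n M N : nat).

Definition nsq n x : \bar R := gauss_sq (fun i : 'I_n => x i).

(** The norm is the infimum, over rational coefficient vectors [q], of the real functions [g q]
    built from fixed vectors. Sublevel sets are thus countable unions of measurable sets, with no
    separability of [E]. *)
Lemma measurable_norm_lincomb n x d (B : measurableType d) (f : nat -> B -> measurableTypeR R) :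
  (forall i, measurable_fun setT (f i)) ->
  measurable_fun setT (fun b => `|\sum_(i < n) f i b *: x i| : R).
Proof.
move=> mf mT; apply: (measurability _ (RGenInftyO.measurableE R)) => //.
move=> _ [_ [r ->] <-]; rewrite setTI.
pose g (q : {ffun 'I_n -> rat}) b : R :=
  `|\sum_(i < n) ratr (q i) *: x i| + \sum_(i < n) `|f i b - ratr (q i)| * `|x i|.
have gE q b : `|\sum_(i < n) f i b *: x i| <= g q b.
  have -> : \sum_(i < n) f i b *: x i =
      \sum_(i < n) ratr (q i) *: x i + \sum_(i < n) (f i b - ratr (q i)) *: x i.
    by rewrite -big_split; apply: eq_bigr => i _ /=; rewrite -scalerDl addrC subrK.
  rewrite (le_trans (ler_normD _ _))// lerD2l (le_trans (ler_norm_sum _ _ _))//.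
  by apply: ler_sum => i _; rewrite normrZ.
rewrite [X in measurable X](_ : _ =
    \bigcup_(q in [set: {ffun 'I_n -> rat}]) (g q @^-1` `]-oo, r[)).
  apply: countable_bigcupT_measurable; first exact: countableP.
  move=> q; rewrite -[X in measurable X]setTI.
  have mg : measurable_fun [set: B] (g q).
    apply: measurable_funD => //; apply: measurable_sum => i.
    apply: measurable_funM => //; apply: measurableT_comp => //.
    by apply: measurable_funB => //; exact: mf.
  exact: mg.
apply/seteqP; split => b /=; last first.
  by move=> [q _] /=; rewrite !in_itv/=; exact: le_lt_trans.
rewrite in_itv/= => br.
pose D := r - `|\sum_(i < n) f i b *: x i|.
have D0 : 0 < D by rewrite subr_gt0.
pose S := \sum_(i < n) `|x i|.
have S0 : 0 <= S by apply: sumr_ge0.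
(* The rational approximation costs [del * S] twice, in the norm and in the correction term, and
   [2 * del * S < D]; the [+ 1] covers [S = 0]. *)
pose del := D / (2 * (S + 1)).
have del0 : 0 < del by rewrite divr_gt0// mulr_gt0// ltr_wpDl.
have /choice[q qE] : forall i : 'I_n, exists q : rat, `|f i b - ratr q| < del.
  move=> i; have [|q] := @rat_in_itvoo R (f i b - del) (f i b + del); first by lra.
  rewrite in_itv/= => /andP[q1 q2]; exists q; rewrite ltr_norml; apply/andP; split; lra.
exists [ffun i => q i] => //=; rewrite in_itv/=.
have sm : \sum_(i < n) `|f i b - ratr (q i)| * `|x i| <= del * S.
  rewrite mulr_sumr; apply: ler_sum => i _.
  by rewrite ler_wpM2r// ltW.
have nm : `|\sum_(i < n) ratr (q i) *: x i| <= `|\sum_(i < n) f i b *: x i| + del * S.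
  have -> : \sum_(i < n) ratr (q i) *: x i =
      \sum_(i < n) f i b *: x i - \sum_(i < n) (f i b - ratr (q i)) *: x i.
    rewrite -sumrB; apply: eq_bigr => i _ /=; rewrite scalerBl opprB addrC subrK //.
  rewrite (le_trans (ler_normB _ _))// lerD2l (le_trans (ler_norm_sum _ _ _))//.
  by apply: le_trans sm; apply: ler_sum => i _; rewrite normrZ.
have dS : del * S + del * S < D.
  have -> : D = del * S + del * S + del + del by rewrite /del; field; lra.
  by lra.
rewrite /g; under eq_bigr do rewrite ffunE.
under [X in _ + X]eq_bigr do rewrite ffunE.
by move: dS; rewrite /D; lra.
Qed.

Let F n x (v : nat -> R) : \bar R := (`|\sum_(i < n) v i *: x i| ^+ 2)%:E.

Let F0 n x v : (0 <= F n x v)%E. Proof. by rewrite lee_fin sqr_ge0. Qed.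

Let fmeasF n x : fmeas (F n x).
Proof.
move=> d B f mf; apply/measurable_EFinP; apply: measurable_funX.
exact: measurable_norm_lincomb.
Qed.

Let nsqE n x : nsq n x = gauss_int n (F n x). Proof. by []. Qed.

Lemma nsq_ge0 n x : (0 <= nsq n x)%E. Proof. exact: gauss_int_ge0. Qed.

Lemma eq_nsq n x y : (forall i, (i < n)%N -> x i = y i) -> nsq n x = nsq n y.
Proof. by move=> xy; congr (gauss_sq _); apply/funext => i; exact: xy. Qed.

(* Convexity of the square norm and symmetry of the last Gaussian. *)
Lemma nsqS n x : (nsq n x <= nsq n.+1 x)%E.
Proof.
pose h t := gauss_int n (fun v => F n.+1 x (upd n t v)).
have mh : measurable_fun [set: measurableTypeR R] h by exact: measurable_gauss_int1.
have h0 t : (0 <= h t)%E by exact: gauss_int_ge0.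
have mhN : measurable_fun [set: measurableTypeR R] (fun t => h (- t)) by exact: measurableT_comp.
have FE t v : F n.+1 x (upd n t v) = (`|\sum_(i < n) v i *: x i + t *: x n| ^+ 2)%:E.
  rewrite /F big_ord_recr/= /upd eqxx; congr ((`|_ + _| ^+ 2)%:E).
  by apply: eq_bigr => i _; rewrite (ltn_eqF (ltn_ord i)).
have fm t : fmeas (fun v => F n.+1 x (upd n t v)).
  exact: (pmeas_fmeas t (fmeas_upd n (fmeasF n.+1 x))).
have hh t : (nsq n x + nsq n x <= h t + h (- t)%R)%E.
  rewrite nsqE -!gauss_intD//; apply: le_gauss_int => //.
  - by move=> d B f mf; apply: emeasurable_funD; apply: fmeasF.
  - by move=> d B f mf; apply: emeasurable_funD; apply: fm.
  - by move=> v; rewrite adde_ge0.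
  - move=> v; rewrite !FE -!EFinD lee_fin.
    set u := \sum_(i < n) v i *: x i; set w := t *: x n.
    have : `|u + u| <= `|u + w| + `|u + - t *: x n|.
      rewrite scaleNr -/w (le_trans _ (ler_normD _ _))//.
      by rewrite addrACA subrr addr0.
    rewrite -mulr2n normrMn -mulr_natr.
    have := normr_ge0 u; have := normr_ge0 (u + w); have := normr_ge0 (u + - t *: x n).
    move: `|u| `|u + w| `|u + - t *: x n| => a b c c0 b0 a0 abc.
    have : (a * 2) ^+ 2 <= (b + c) ^+ 2 by rewrite ler_pXn2r ?nnegrE ?mulr_ge0 ?addr_ge0.
    by have := sqr_ge0 (b - c); lra.
have : (2%:E * nsq n x <= 2%:E * nsq n.+1 x)%E.
  have E2 (z : \bar R) : (2%:E * z = z + z)%E by rewrite mule_natl mule2n.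
  rewrite !E2 [leRHS](_ : _ = \int[normal_prob (0 : R) 1]_t (h t + h (- t)%R))%E; last first.
    rewrite ge0_integralD//; congr (_ + _)%E.
    exact: (esym (integral_normalN mh h0)).
  apply: le_trans (_ : (\int[normal_prob (0 : R) 1]_t (nsq n x + nsq n x) <= _)%E); last first.
    apply: ge0_le_integral => //; first by move=> t _; rewrite adde_ge0// nsq_ge0.
    exact: emeasurable_funD.
  rewrite integral_cst//.
  rewrite [X in (_ <= _ * X)%E](@probability_setT _ _ R (normal_prob (0 : R) 1)).
  by rewrite mule1.
by rewrite lee_pmul2l// lte_fin.
Qed.

Lemma nsq_le n m x : (n <= m)%N -> (nsq n x <= nsq m x)%E.
Proof.
elim: m => [|m IH]; first by rewrite leqn0 => /eqP ->.
rewrite leq_eqVlt => /orP[/eqP -> //|/IH h]; exact: le_trans h (nsqS m x).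
Qed.

(** The rows of [A] are completed to an isometry, which leaves the Gaussian norm of [y] unchanged;
    the added rows are then dropped by [nsq_le]. *)
Lemma nsq_contraction M N (A : nat -> nat -> R) y :
  (forall a : nat -> R, \sum_(i < M) (\sum_(j < N) A i j * a j) ^+ 2 <= \sum_(j < N) a j * a j) ->
  (nsq M (fun i => \sum_(j < N) A i j *: y j)%R <= nsq N y)%E.
Proof.
move=> /contraction_completion[W [WA Wiso]].
rewrite [leRHS]nsqE -(gauss_int_isometry Wiso)//.
apply: le_trans (_ : nsq (M + N) (fun i => \sum_(j < N) W i j *: y j)%R <= _)%E; last first.
  rewrite le_eqVlt; apply/orP; left; apply/eqP; apply: eq_gauss_int => v.
  congr ((`|_| ^+ 2)%:E); rewrite /lin.
  under [RHS]eq_bigr do rewrite ltn_ord scaler_suml.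
  rewrite exchange_big/=; apply: eq_bigr => i _; rewrite scaler_sumr.
  by apply: eq_bigr => j _; rewrite scalerA mulrC.
apply: le_trans (nsq_le _ (leq_addr N M)).
by rewrite (@eq_nsq _ _ (fun i => \sum_(j < N) W i j *: y j))// => i iM; rewrite WA.
Qed.

(** The pointwise inequality with a free weight [d] stands in for Minkowski's inequality in L^2;
    [nrmD] recovers the triangle inequality by optimising [d]. *)
Lemma nsqD n x y (d : R) : 0 < d ->
  (nsq n (fun i => x i + y i)%R <= (1 + d)%R%:E * nsq n x + (1 + d^-1)%R%:E * nsq n y)%E.
Proof.
move=> d0; rewrite !nsqE.
have d1 : 0 <= 1 + d by lra.
have d2 : 0 <= 1 + d^-1 by rewrite addr_ge0// invr_ge0 ltW.
have mz (k : R) z : fmeas (fun v => k%:E * F n z v)%E.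
  by move=> D B f mf; apply: emeasurable_funM => //; exact: fmeasF.
have z0 (k : R) z v : 0 <= k -> (0 <= k%:E * F n z v)%E.
  by move=> k0; rewrite mule_ge0.
rewrite -!gauss_intZ// -gauss_intD//; [|by move=> v; exact: z0..].
apply: le_gauss_int => //.
  by move=> D B f mf; apply: emeasurable_funD; exact: mz.
move=> v; rewrite -!EFinM -EFinD lee_fin.
under eq_bigr do rewrite scalerDr.
rewrite big_split/=; set u := \sum_(i < n) _; set w := \sum_(i < n) _.
apply: le_trans (_ : (`|u| + `|w|) ^+ 2 <= _).
  by rewrite ler_pXn2r ?nnegrE ?addr_ge0// ler_normD.
rewrite -subr_ge0.
have -> : (1 + d) * `|u| ^+ 2 + (1 + d^-1) * `|w| ^+ 2 - (`|u| + `|w|) ^+ 2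
  = d^-1 * (d * `|u| - `|w|) ^+ 2 by field; lra.
by rewrite mulr_ge0 ?invr_ge0 ?sqr_ge0// ltW.
Qed.

Lemma nsq1 x : nsq 1 x = (normal_sqr * `|x 0%N| ^+ 2)%:E.
Proof.
rewrite nsqE /= /F.
under eq_integral do rewrite big_ord1 eqxx normrZ exprMn real_normK ?num_real// EFinM.
rewrite ge0_integralZr//; last 2 first.
- exact/measurable_EFinP/measurable_funX.
- by move=> t _; rewrite lee_fin sqr_ge0.
by rewrite -[X in (X * _)%E]fineK ?integral_normal_sqr_fin_num.
Qed.

Lemma nsqZ n x (k : R) : nsq n (fun i => k *: x i) = ((k ^+ 2)%:E * nsq n x)%E.
Proof.
rewrite !nsqE -gauss_intZ ?sqr_ge0//; apply: eq_gauss_int => v.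
rewrite /F -EFinM; congr EFin.
under eq_bigr do rewrite scalerA mulrC -scalerA.
by rewrite -scaler_sumr normrZ exprMn real_normK ?num_real.
Qed.

(** Split off the last vector. Each of the two parts, padded with zeros, is the image of a shorter
    family under a coordinate embedding, which is a contraction. *)
Lemma nsq_fin_num n x : nsq n x \is a fin_num.
Proof.
elim: n x => [|n IH] x; first by [].
have S1 : (nsq n.+1 (fun i => if i == n then x n else 0%R) <= nsq 1 (fun=> x n))%E.
  rewrite (@eq_nsq _ _ (fun i => \sum_(j < 1) (i == n)%:R *: x n)); last first.
    by move=> i _; rewrite big_ord1; case: eqP; rewrite ?scale1r ?scale0r.
  apply: (@nsq_contraction n.+1 1 (fun i _ => (i == n)%:R) (fun=> x n)) => a.
  rewrite big_ord_recr/= big1 ?add0r ?big_ord1 ?eqxx ?mul1r// => i _.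
  by rewrite big_ord1 (ltn_eqF (ltn_ord i)) mul0r expr0n.
have S2 : nsq n.+1 (fun i => if i == n then 0 else x i) = nsq n x.
  apply/eqP; rewrite eq_le; apply/andP; split; last first.
    by apply: le_trans (nsqS _ _); rewrite (@eq_nsq _ x (fun i => if i == n then 0 else x i))// => i /ltn_eqF ->.
  rewrite (@eq_nsq _ _ (fun i => \sum_(j < n) (i == j)%:R *: x j)); last first.
    move=> i; rewrite ltnS leq_eqVlt => /orP[/eqP ->|iN].
      by rewrite eqxx big1// => j _; rewrite (gtn_eqF (ltn_ord j)) scale0r.
    rewrite (ltn_eqF iN) (bigD1 (Ordinal iN))//= eqxx scale1r big1 ?addr0// => j.
    by rewrite -val_eqE/= eq_sym => /negbTE ->; rewrite scale0r.
  apply: (@nsq_contraction n.+1 n (fun i j => (i == j)%:R) x) => a.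
  rewrite big_ord_recr/= [X in _ + X ^+ 2]big1 ?expr0n ?addr0; last first.
    by move=> j _; rewrite (gtn_eqF (ltn_ord j)) mul0r.
  apply: ler_sum => i _; rewrite (bigD1 i)//= eqxx mul1r big1 ?addr0 ?expr2// => j.
  by rewrite -val_eqE/= eq_sym => /negbTE ->; rewrite mul0r.
rewrite ge0_fin_numE ?nsq_ge0//.
rewrite (@eq_nsq _ _ (fun i => (if i == n then 0 else x i) + (if i == n then x n else 0))); last first.
  by move=> i _; case: eqP => [->|]; rewrite ?add0r ?addr0.
apply: le_lt_trans (nsqD _ _ _ ltr01) _.
rewrite S2 lte_add_pinfty//.
  by rewrite lte_mul_pinfty// ?lee_fin ?addr_ge0// -ge0_fin_numE ?nsq_ge0.
rewrite lte_mul_pinfty// ?lee_fin ?addr_ge0 ?invr_ge0//.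
by apply: le_lt_trans S1 _; rewrite nsq1 ltry.
Qed.

Definition nrm n x : R := Num.sqrt (fine (nsq n x)).

Lemma nrm_ge0 n x : 0 <= nrm n x. Proof. exact: sqrtr_ge0. Qed.

Lemma sqr_nrm n x : (nrm n x ^+ 2)%:E = nsq n x.
Proof. by rewrite sqr_sqrtr ?fineK ?nsq_fin_num// fine_ge0// nsq_ge0. Qed.

Lemma nrm_nsq n m x y : (nsq n x <= nsq m y)%E -> nrm n x <= nrm m y.
Proof.
rewrite -!sqr_nrm lee_fin ler_pXn2r// ?nnegrE ?nrm_ge0//.
Qed.

Lemma nrmD n x y : nrm n (fun i => x i + y i) <= nrm n x + nrm n y.
Proof.
set a := nrm n x; set b := nrm n y; set c := nrm n _.
have a0 : 0 <= a := nrm_ge0 _ _.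
have b0 : 0 <= b := nrm_ge0 _ _.
have H d : 0 < d -> c ^+ 2 <= (1 + d) * a ^+ 2 + (1 + d^-1) * b ^+ 2.
  by move=> d0; have := nsqD n x y d0; rewrite -!sqr_nrm -!EFinM -EFinD lee_fin.
apply/ler_addgt0Pr => eps e0.
have e2 : 0 < eps / 2 by lra.
(* The optimal weight is [b / a]; the shifts by [eps / 2] keep it defined and positive when a norm
   vanishes. *)
have := H ((b + eps / 2) / (a + eps / 2)).
rewrite divr_gt0 ?ltr_wpDl// => /(_ isT).
rewrite invf_div => Hc.
rewrite -(@ler_pXn2r _ 2)// ?nnegrE ?nrm_ge0 ?addr_ge0// ?(ltW e0)//.
apply: le_trans Hc _.
apply: le_trans (_ : (1 + (b + eps / 2) / (a + eps / 2)) * (a + eps / 2) ^+ 2 +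
  (1 + (a + eps / 2) / (b + eps / 2)) * (b + eps / 2) ^+ 2 <= _).
  apply: lerD; apply: ler_wpM2l.
  - by rewrite addr_ge0// divr_ge0// addr_ge0// ltW.
  - by rewrite ler_pXn2r ?nnegrE ?addr_ge0 ?(ltW e2)//; lra.
  - by rewrite addr_ge0// divr_ge0// addr_ge0// ltW.
  - by rewrite ler_pXn2r ?nnegrE ?addr_ge0 ?(ltW e2)//; lra.
rewrite le_eqVlt; apply/orP; left; apply/eqP; field.
by apply/andP; split; rewrite gt_eqF//; lra.
Qed.

Lemma nrmZ n x (k : R) : nrm n (fun i => k *: x i) = `|k| * nrm n x.
Proof.
rewrite /nrm nsqZ fineM ?nsq_fin_num//= sqrtrM ?sqr_ge0//.
by rewrite sqrtr_sqr.
Qed.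

Lemma nrm_contraction M N (A : nat -> nat -> R) y :
  (forall a : nat -> R, \sum_(i < M) (\sum_(j < N) A i j * a j) ^+ 2 <= \sum_(j < N) a j * a j) ->
  nrm M (fun i => \sum_(j < N) A i j *: y j) <= nrm N y.
Proof. by move=> Ac; apply: nrm_nsq; exact: nsq_contraction. Qed.

Lemma nrm1 x : nrm 1 x = Num.sqrt normal_sqr * `|x 0%N|.
Proof. by rewrite /nrm nsq1/= sqrtrM ?(ltW normal_sqr_gt0)// sqrtr_sqr normr_id. Qed.

(** A row of norm at most 1 is a contraction onto one dimension, where the Gaussian norm is
    explicit. *)
Lemma nrm_lincomb_le N y (a : nat -> R) : \sum_(j < N) a j * a j <= 1 ->
  Num.sqrt normal_sqr * `|\sum_(j < N) a j *: y j| <= nrm N y.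
Proof.
move=> a1; have := @nrm_contraction 1 N (fun _ => a) y; rewrite nrm1; apply => b.
rewrite big_ord1.
have := @discr_le R (\sum_(j < N) b j * b j) (\sum_(j < N) a j * b j) (\sum_(j < N) a j * a j).
move=> H; apply: le_trans (H _ _) _.
- move=> t; rewrite [leRHS](_ : _ = \sum_(j < N) (b j + t * a j) ^+ 2).
    by apply: sumr_ge0 => i _; rewrite sqr_ge0.
  rewrite !mulr_sumr -!big_split/=; apply: eq_bigr => i _; ring.
- by apply: sumr_ge0 => i _; rewrite -expr2 sqr_ge0.
by rewrite ler_piMr//; apply: sumr_ge0 => i _; rewrite -expr2 sqr_ge0.
Qed.

End gauss_sq.

(** * Hahn-Banach, compactness and Hilbert space *)

Section limits.
Context {R : realType}.

Lemma cvg_seqP (V : normedModType R) (u : nat -> V) (l : V) :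
  u @ \oo --> l <->
  forall e : R, 0 < e -> exists K, forall n, (K <= n)%N -> `|u n - l| < e.
Proof.
split.
  move=> /cvgrPdist_lt ul e e0; have [K _ KP] := ul e e0.
  by exists K => n Kn; rewrite distrC; exact: KP.
move=> ul; apply/cvgrPdist_lt => e e0; have [K KP] := ul e e0.
by exists K => // n /= Kn; rewrite distrC; exact: KP.
Qed.

Lemma cauchy_seq_cvg (V : completeNormedModType R) (u : nat -> V) :
  (forall e : R, 0 < e -> exists K, forall m n, (K <= m)%N -> (K <= n)%N -> `|u m - u n| < e) ->
  exists l : V, u @ \oo --> l.
Proof.
move=> uC; exists (lim (u @ \oo)); apply/cvg_ex.
suff : cvg (u @ \oo) by move=> /cvg_ex.
apply/cauchy_cvgP; apply: cauchy_exP => e e0.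
have [K KP] := uC e e0; exists (u K).
by exists K => // n /= Kn; rewrite -ball_normE /=; exact: KP.
Qed.

Lemma inv_succ_lt (e : R) : 0 < e -> exists K, forall n, (K <= n)%N -> n.+1%:R^-1 < e.
Proof.
move=> e0; have [K _ KP] := @near_infty_natSinv_lt R (PosNum e0); exists K => n Kn; exact: KP.
Qed.

End limits.

Section linear_maps.
Context {R : realType} {V W : normedModType R}.
Implicit Types f : V -> W.

Lemma is_linear0 f : is_linear f -> f 0 = 0.
Proof.
move=> lf; have := lf (-1) 0 0; rewrite scaler0 addr0 scaleN1r => {1}->.
by rewrite addNr.
Qed.

Lemma is_linearZ f a u : is_linear f -> f (a *: u) = a *: f u.
Proof. by move=> lf; rewrite -[a *: u]addr0 lf is_linear0// addr0. Qed.

Lemma is_linearD f u v : is_linear f -> f (u + v) = f u + f v.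
Proof. by move=> lf; rewrite -[u]scale1r lf !scale1r. Qed.

Lemma is_linearB f u v : is_linear f -> f (u - v) = f u - f v.
Proof. by move=> lf; rewrite -scaleN1r addrC lf scaleN1r addrC. Qed.

Lemma is_linear_sum f n (u : nat -> V) : is_linear f ->
  f (\sum_(i < n) u i) = \sum_(i < n) f (u i).
Proof.
move=> lf; elim: n => [|n IH]; first by rewrite !big_ord0 is_linear0.
by rewrite !big_ord_recr/= is_linearD// IH.
Qed.

Lemma is_linear_lincomb f n (a : nat -> R) (u : nat -> V) : is_linear f ->
  f (\sum_(i < n) a i *: u i) = \sum_(i < n) a i *: f (u i).
Proof.
move=> lf; rewrite (is_linear_sum n (fun i => a i *: u i))//.
by apply: eq_bigr => i _; rewrite is_linearZ.
Qed.

Lemma bounded_linearP f : bounded_linear f <->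
  is_linear f /\ exists C, 0 < C /\ forall x, `|f x| <= C * `|x|.
Proof.
split=> [[lf cf]|[lf [C [C0 CP]]]]; split => //.
  pose g : {linear V -> W} := HB.pack f (GRing.isLinear.Build R V W *:%R f lf).
  have /linear_bounded_continuous/linear_boundedP : continuous g by [].
  by move=> /pinfty_ex_gt0 [C C0 CP]; exists C.
move=> x; apply/cvgrPdist_lt => e e0; near=> y.
rewrite -is_linearB//; apply: le_lt_trans (CP _) _.
rewrite mulrC -ltr_pdivlMr//; near: y.
by apply: cvgr_dist_lt => //; rewrite divr_gt0.
Unshelve. all: by end_near. Qed.

End linear_maps.

Section hahn_banach.
Context {R : realType} {E : normedModType R}.

(** A partial functional is encoded by its graph. The bound by the norm also makes the graph
    single-valued: apply it to the difference of two pairs over the same vector, with both signs. *)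
Let lin_graph (G : set (E * R)) :=
  (forall a p q, G p -> G q -> G (a *: p.1 + q.1, a * p.2 + q.2)) /\
  (forall p, G p -> p.2 <= `|p.1|).

(** The triangle inequality puts every [p.2 - |p.1 - e|] below every [|q.1 + e| - q.2], and any [c]
    in between works: scaling by [|t|] reduces the bound to [t = 1] and [t = -1]. *)
Let extension (G : set (E * R)) (e : E) : lin_graph G -> G !=set0 -> exists c,
  lin_graph [set (p.1.1 + p.2 *: e, p.1.2 + p.2 * c) | p in [set p : (E * R) * R | G p.1]].
Proof.
move=> [Glin Gle] [p0 Gp0].
pose A := [set p.2 - `|p.1 - e| | p in G].
have Aub p q : G p -> G q -> p.2 - `|p.1 - e| <= `|q.1 + e| - q.2.
  move=> Gp Gq; rewrite lerBlDr addrAC lerBrDr.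
  have := Gle _ (Glin 1 p q Gp Gq); rewrite /= scale1r mul1r => /le_trans; apply.
  by rewrite (le_trans _ (ler_normD _ _))// addrACA subrr addr0 addrC.
have G0 : G (0, 0).
  by have := Glin (-1) p0 p0 Gp0 Gp0; rewrite scaleN1r mulN1r !addNr.
have GZ a p : G p -> G (a *: p.1, a * p.2).
  by move=> Gp; have := Glin a p _ Gp G0; rewrite /= !addr0.
have supA : has_sup A.
  split; first by exists (p0.2 - `|p0.1 - e|), p0.
  by exists (`|p0.1 + e| - p0.2) => _ [p Gp <-]; exact: Aub.
exists (sup A); split.
  move=> a _ _ [[p t] /= Gp <-] [[q s] /= Gq <-] /=.
  exists ((a *: p.1 + q.1, a * p.2 + q.2), a * t + s) => /=; first exact: Glin.
  congr pair; last by ring.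
  by rewrite scalerDr scalerDl scalerA addrACA.
move=> _ [[p t] /= Gp <-] /=.
have [t0|t0|->] := ltgtP t 0; last by rewrite scale0r mul0r !addr0; exact: Gle.
- have u0 : 0 < - t by rewrite oppr_gt0.
  have : (- t)^-1 * p.2 - `|(- t)^-1 *: p.1 - e| <= sup A.
    by apply: ub_le_sup; [case: supA|exists ((- t)^-1 *: p.1, (- t)^-1 * p.2) => //; exact: GZ].
  rewrite -(ler_pM2l u0) mulrBr mulrA mulfV ?gt_eqF// mul1r.
  have -> : - t * `|(- t)^-1 *: p.1 - e| = `|p.1 + t *: e|.
    rewrite -[X in X * _](gtr0_norm u0) -normrZ scalerBr scalerA mulfV ?gt_eqF// scale1r.
    by rewrite scaleNr opprK.
  by lra.
- have : sup A <= `|t^-1 *: p.1 + e| - t^-1 * p.2.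
    apply: ge_sup; first by case: supA.
    by move=> _ [q Gq <-]; exact: (Aub q _ Gq (GZ t^-1 p Gp)).
  rewrite lerBrDr -(ler_pM2l t0) mulrDr mulrA mulfV ?gt_eqF// mul1r.
  have -> : t * `|t^-1 *: p.1 + e| = `|p.1 + t *: e|.
    by rewrite -[X in X * _](gtr0_norm t0) -normrZ scalerDr scalerA mulfV ?gt_eqF// scale1r.
  by lra.
Qed.

Lemma hahn_banach (z : E) : exists f : E -> R^o, dual_elt f /\ f z = `|z|.
Proof.
(* The implication admits the empty graph, which is the union of the empty chain in Zorn's lemma;
   [A0] excludes it for the maximal graph. *)
pose P (G : set (E * R)) := lin_graph G /\ (G !=set0 -> G (z, `|z|)).
have [A [[Alin Az] Amax]] : exists A, P A /\ forall B, A `<` B -> ~ P B.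
  apply: Zorn_bigcup => F FP Ftot; split; last first.
    by move=> [p [X FX Xp]]; exists X => //; apply: (FP X FX).2; exists p.
  split; last by move=> p [X FX Xp]; exact: (FP X FX).1.2.
  move=> a p q [X FX Xp] [Y FY Yq].
  have [XY|YX] := Ftot X Y FX FY.
    by exists Y => //; apply: (FP Y FY).1.1 => //; exact: XY.
  by exists X => //; apply: (FP X FX).1.1 => //; exact: YX.
have A0 : A !=set0.
  apply: contrapT => /set0P/negP/negPn/eqP A0.
  pose B := [set (t *: z, t * `|z|) | t in [set: R]].
  have Bz : B (z, `|z|) by exists 1 => //; rewrite scale1r mul1r.
  apply: (Amax B); first by rewrite A0; split => // /(_ _ Bz).
  split => //; split.
    move=> a _ _ [t _ <-] [u _ <-] /=; exists (a * t + u) => //=.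
    by rewrite scalerDl scalerA mulrDl mulrA.
  by move=> _ [t _ <-] /=; rewrite normrZ ler_wpM2r// ler_norm.
have AZ := Az A0; have [Al Ale] := Alin.
have A00 : A (0, 0).
  by have := Al (-1) _ _ AZ AZ; rewrite scaleN1r mulN1r !addNr.
have Atot e : exists r, A (e, r).
  apply: contrapT => /forallNP ne.
  have [c] := extension e Alin A0; set B := [set _ | _ in _] => Blin.
  have AB : A `<=` B by move=> [x r] Axr; exists ((x, r), 0) => //=; rewrite scale0r mul0r !addr0.
  apply: (Amax B); last by split => // _; exact: AB.
  split => // /(_ (e, c)) BA; apply: (ne c); apply: BA.
  by exists ((0, 0), 1) => //=; rewrite scale1r mul1r !add0r.
have Auniq e r s : A (e, r) -> A (e, s) -> r = s.
  move=> Ar As; have := Ale _ (Al (-1) _ _ Ar As); have := Ale _ (Al (-1) _ _ As Ar).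
  by rewrite /= scaleN1r !mulN1r addNr normr0; lra.
have [f fA] := choice Atot.
have lf : is_linear (f : E -> R^o).
  by move=> a u v; apply: Auniq (fA _) _; exact: (Al a _ _ (fA u) (fA v)).
exists f; split; last exact: Auniq (fA z) AZ.
apply/bounded_linearP; split => //; exists 1; split => // x; rewrite mul1r.
have fN : f (- x) = - f x by have := is_linearZ (-1) x lf; rewrite !scaleN1r.
rewrite ler_norml; have := Ale _ (fA x); have := Ale _ (fA (- x)) => /=.
by rewrite fN normrN => h1 h2; apply/andP; split; lra.
Qed.

End hahn_banach.

Section compactness.
Context {R : realType}.

Lemma ultra_compact_cvg {T : Type} (U : set_system T) {V : normedModType R} (K : set V)
    (a : T -> V) : UltraFilter U -> compact K -> (forall j, K (a j)) ->
  exists p, forall e : R, 0 < e -> U [set j | `|a j - p| < e].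
Proof.
move=> UU cK aK.
have UK : U (a @^-1` K) by apply: filterS filterT => j _; exact: aK.
have [p [_ clp]] := cK (a @ U) _ UK; exists p => e e0.
have [//|nU] := in_ultra_setVsetC [set j | `|a j - p| < e] UU.
have [x [xB]] := clp [set x | ~ `|x - p| < e] _ nU (nbhsx_ballx p e e0).
by rewrite -ball_normE/= distrC => /xB.
Qed.

(** Passage from sequences to filters: without a finite [e]-net, greedy choice yields a sequence
    with pairwise distances at least [e]. With nets, every ultrafilter on the closure is Cauchy, and
    completeness applies. *)
Lemma precompact_seq (V : completeNormedModType R) (A : set V) :
  (forall (e : R) (u : nat -> V), 0 < e -> (forall n, A (u n)) ->
     exists i j, (i < j)%N /\ `|u i - u j| < e) ->
  compact (closure A).
Proof.
move=> H.
have tb (e : R) : 0 < e -> exists s : seq V, forall x, A x -> exists2 y, y \in s & `|y - x| < e.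
  move=> e0; apply: contrapT => /forallNP ns.
  have /choice[g gP] (s : seq V) : exists x, A x /\ forall y, y \in s -> e <= `|y - x|.
    have /existsNP[x /not_implyP[Ax nx]] := ns s.
    exists x; split => // y ys; rewrite leNgt; apply/negP => yx.
    by apply: nx; exists y.
  pose s := fix s n := if n is m.+1 then g (s m) :: s m else [::].
  have us i j : (i < j)%N -> g (s i) \in s j.
    elim: j => [//|j IH]; rewrite ltnS leq_eqVlt => /orP[/eqP ->|ij] /=.
      by rewrite mem_head.
    by rewrite inE IH ?orbT.
  have [i [j [ij]]] := H e (g \o s) e0 (fun n => (gP (s n)).1).
  by rewrite ltNge => /negP; apply; apply: (gP (s j)).2; exact: us.
rewrite compact_ultra => F FU FA.
have FC : cauchy F.
  apply: cauchy_exP => e e0.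
  have e2 : 0 < e / 2 by rewrite divr_gt0.
  (* An [e / 2]-net of [A] is taken because the balls of radius [e] have to cover the closure of
     [A]. If none of them belonged to [F], the ultrafilter would contain all their complements. *)
  have [s sP] := tb _ e2.
  apply: contrapT => /forallNP nF.
  have Fs : F [set x | forall y, y \in s -> ~ ball y e x].
    elim: s {sP} => [|y s IH]; first by apply: filterS filterT => x _ y.
    have [/nF//|Fy] := in_ultra_setVsetC (ball y e) FU.
    apply: filterS (filterI Fy IH) => x [/= nyx sx] z; rewrite inE => /orP[/eqP ->//|].
    exact: sx.
  have [x [/= Ax nx]] := filter_ex (filterI FA Fs).
  have [z [Az]] := Ax _ (nbhsx_ballx x (e / 2) e2).
  rewrite -ball_normE/= => xz.
  have [y ys yz] := sP z Az; apply: (nx y ys).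
  rewrite -ball_normE/= (le_lt_trans (ler_distD z _ _))// (splitr e).
  by rewrite ltrD// distrC.
have /cauchy_cvgP/cvg_ex[p Fp] := FC.
exists p; split => //.
have := @closed_closure _ A => /closure_id ->; move=> B /Fp FB.
exact: filter_ex (filterI FA FB).
Qed.

End compactness.

(** * Finite orthonormal systems in an inner product space *)

Section inner_product.
Context {R : realType} {H : normedModType R}.
Variable ip : H -> H -> R.
Hypothesis hip : inner_product ip.

Lemma ipC x y : ip x y = ip y x. Proof. by case: hip. Qed.

Lemma ipxx x : ip x x = `|x| ^+ 2. Proof. by case: hip. Qed.

Lemma is_linear_ip y : is_linear (ip ^~ y : H -> R^o).
Proof. by move=> a u v; case: hip => _ + _; apply. Qed.

Lemma is_linear_ipr x : is_linear (ip x : H -> R^o).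
Proof. by move=> a u v; rewrite ipC (is_linear_ip x a u v) !(ipC _ x). Qed.

Lemma ipDl x y z : ip (x + y) z = ip x z + ip y z. Proof. exact: (is_linearD x y (is_linear_ip z)). Qed.
Lemma ipBl x y z : ip (x - y) z = ip x z - ip y z. Proof. exact: (is_linearB x y (is_linear_ip z)). Qed.
Lemma ipZl a x z : ip (a *: x) z = a * ip x z. Proof. exact: (is_linearZ a x (is_linear_ip z)). Qed.
Lemma ip0l z : ip 0 z = 0. Proof. exact: (is_linear0 (is_linear_ip z)). Qed.
Lemma ipDr x y z : ip z (x + y) = ip z x + ip z y. Proof. exact: (is_linearD x y (is_linear_ipr z)). Qed.
Lemma ipBr x y z : ip z (x - y) = ip z x - ip z y. Proof. exact: (is_linearB x y (is_linear_ipr z)). Qed.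
Lemma ipZr a x z : ip z (a *: x) = a * ip z x. Proof. exact: (is_linearZ a x (is_linear_ipr z)). Qed.
Lemma ip_suml n (u : nat -> H) z : ip (\sum_(i < n) u i) z = \sum_(i < n) ip (u i) z.
Proof. exact: (is_linear_sum n u (is_linear_ip z)). Qed.
Lemma ip_sumr n (u : nat -> H) z : ip z (\sum_(i < n) u i) = \sum_(i < n) ip z (u i).
Proof. exact: (is_linear_sum n u (is_linear_ipr z)). Qed.

Lemma ip_eq x y : (forall k, ip x k = ip y k) -> x = y.
Proof.
move=> xy; apply/eqP; rewrite -subr_eq0 -normr_eq0 -sqrf_eq0 -ipxx ipBl xy subrr//.
Qed.

Lemma ip_CS2 x y : ip x y ^+ 2 <= `|x| ^+ 2 * `|y| ^+ 2.
Proof.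
apply: discr_le => [t|]; last exact: sqr_ge0.
have := sqr_ge0 `|x + t *: y|; rewrite -!ipxx ipDl !ipDr !ipZl !ipZr (ipC y x).
by congr (_ <= _); ring.
Qed.

Lemma ip_CS x y : `|ip x y| <= `|x| * `|y|.
Proof.
rewrite -(@ler_pXn2r _ 2)// ?nnegrE ?mulr_ge0//.
by rewrite real_normK ?num_real// exprMn ip_CS2.
Qed.

Definition onb N (h : nat -> H) :=
  forall i j, (i < N)%N -> (j < N)%N -> ip (h i) (h j) = (i == j)%:R.

Definition oproj N (h : nat -> H) k := \sum_(i < N) ip k (h i) *: h i.

Lemma ip_lincomb_onb N h (a : nat -> R) j : onb N h -> (j < N)%N ->
  ip (\sum_(i < N) a i *: h i) (h j) = a j.
Proof.
move=> oh jN; rewrite (ip_suml N (fun i => a i *: h i)) (bigD1 (Ordinal jN))//=.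
rewrite ipZl oh// eqxx mulr1 big1 ?addr0// => i; rewrite -val_eqE/= => ij.
by rewrite ipZl oh// (negbTE ij) mulr0.
Qed.

Lemma norm_lincomb_onb N h (a : nat -> R) : onb N h ->
  `|\sum_(i < N) a i *: h i| ^+ 2 = \sum_(i < N) a i * a i.
Proof.
move=> oh; rewrite -ipxx (ip_sumr N (fun i => a i *: h i)).
by apply: eq_bigr => i _; rewrite ipZr ip_lincomb_onb.
Qed.

Lemma ip_proj_onb N h k j : onb N h -> (j < N)%N -> ip (oproj N h k) (h j) = ip k (h j).
Proof. exact: (@ip_lincomb_onb N h (fun i => ip k (h i))). Qed.

Lemma ip_proj N h x y : ip (oproj N h x) y = \sum_(i < N) ip x (h i) * ip y (h i).
Proof.
rewrite (ip_suml N (fun i => ip x (h i) *: h i)).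
by apply: eq_bigr => i _; rewrite ipZl (ipC (h i)).
Qed.

Lemma bessel N h k : onb N h -> \sum_(i < N) ip k (h i) * ip k (h i) <= `|k| ^+ 2.
Proof.
move=> oh; have := sqr_ge0 `|k - oproj N h k|; rewrite -(ipxx (k - _)) ipBl !ipBr.
rewrite (ipC k) !ip_proj.
under [X in _ - (_ - X)]eq_bigr => i _ do rewrite (ip_proj_onb _ oh (ltn_ord i)).
by rewrite -ipxx; lra.
Qed.

(** The linear set [D] is carried along because the orthonormal vectors will have to stay in the
    range of [S^*]. *)
Lemma gram_schmidt (D : set H) (vs : seq H) :
  (forall a u v, D u -> D v -> D (a *: u + v)) -> (forall v, v \in vs -> D v) ->
  exists N h, [/\ onb N h, forall i, (i < N)%N -> D (h i) &
    forall v, v \in vs -> v = oproj N h v].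
Proof.
move=> Dlin; elim: vs => [_|v vs IH Dvs]; first by exists 0%N, (fun=> 0); split.
have [|N [h [oh Dh hvs]]] := IH.
  by move=> w wvs; apply: Dvs; rewrite inE wvs orbT.
have Dv : D v by apply: Dvs; rewrite mem_head.
pose r := v - oproj N h v.
have rh i : (i < N)%N -> ip r (h i) = 0.
  by move=> iN; rewrite ipBl ip_proj_onb// subrr.
have [r0|r0] := eqVneq r 0.
  exists N, h; split => // w; rewrite inE => /orP[/eqP ->|]; last exact: hvs.
  by apply/eqP; rewrite -subr_eq0; apply/eqP.
pose e := `|r|^-1 *: r.
pose h' i := if i == N then e else h i.
have h'N : h' N = e by rewrite /h' eqxx.
have h'E i : (i < N)%N -> h' i = h i by move=> iN; rewrite /h' (ltn_eqF iN).
have eh i : (i < N)%N -> ip e (h i) = 0 by move=> iN; rewrite ipZl rh// mulr0.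
have r_neq0 : `|r| != 0 by rewrite normr_eq0.
have projE k : oproj N.+1 h' k = oproj N h k + ip k e *: e.
  rewrite /oproj big_ord_recr/= h'N; congr (_ + _).
  by apply: eq_bigr => i _; rewrite h'E.
exists N.+1, h'; split.
- move=> i j; rewrite ltnS leq_eqVlt => /orP ci; rewrite ltnS leq_eqVlt => /orP cj.
  case: ci => [/eqP ->|iN]; case: cj => [/eqP ->|jN].
  + by rewrite h'N eqxx /e ipZl ipZr ipxx expr2 mulKf// mulVf.
  + by rewrite h'N h'E// eh// (gtn_eqF jN).
  + by rewrite h'N h'E// ipC eh// (ltn_eqF iN).
  + by rewrite !h'E// oh.
- move=> i; rewrite ltnS leq_eqVlt => /orP[/eqP ->|iN]; last by rewrite h'E//; exact: Dh.
  have D0 : D 0 by have := Dlin (-1) v v Dv Dv; rewrite scaleN1r addNr.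
  have Dp n : (n <= N)%N -> D (oproj n h v).
    elim: n => [|n IHn] nN; first by rewrite /oproj big_ord0.
    by rewrite /oproj big_ord_recr/= addrC; apply: Dlin; [exact: Dh|apply: IHn; exact: ltnW].
  rewrite h'N /e -[_ *: r]addr0; apply: (Dlin) => //.
  by rewrite /r addrC -scaleN1r; apply: Dlin => //; exact: Dp.
- move=> w; rewrite inE projE => /orP[/eqP ->|wvs].
    have -> : ip v e = `|r|.
      have -> : v = r + oproj N h v by rewrite /r subrK.
      rewrite ipDl ip_proj big1 ?addr0; last by move=> i _; rewrite eh// mulr0.
      by rewrite ipZr ipxx expr2 mulrA mulVf// mul1r.
    by rewrite scalerA mulfV// scale1r /r addrC subrK.
  rewrite -hvs//; have -> : ip w e = 0; last by rewrite scale0r addr0.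
  rewrite (hvs w wvs) ip_proj big1// => i _; rewrite eh// mulr0//.
Qed.

End inner_product.

Section riesz.
Context {R : realType} {H : completeNormedModType R}.
Variable ip : H -> H -> R.
Hypothesis hip : inner_product ip.

Lemma parallelogram (x y : H) : `|x - y| ^+ 2 = 2 * `|x| ^+ 2 + 2 * `|y| ^+ 2 - `|x + y| ^+ 2.
Proof.
rewrite -(ipxx hip (x - y)) -(ipxx hip (x + y)) (ipBl hip) (ipDl hip) !(ipBr hip) !(ipDr hip).
by rewrite (ipC hip y x) -!(ipxx hip); ring.
Qed.

(* The representing vector minimises |k|^2 - 2 f k. *)
Lemma riesz (g : H -> R^o) : bounded_linear g -> exists h, forall k, ip h k = g k.
Proof.
move=> /bounded_linearP[lg [C [C0 gC]]]; pose f : H -> R := g.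
have fC x : `|f x| <= C * `|x| by exact: gC.
have fD x y : f (x + y) = f x + f y by exact: (is_linearD x y lg).
have fZ a x : f (a *: x) = a * f x by exact: (is_linearZ a x lg).
pose J k := `|k| ^+ 2 - 2 * f k.
pose A := [set J k | k in setT].
have Alb : lbound A (- C ^+ 2).
  move=> _ [k _ <-]; have := ler_norm (f k); have := fC k; have := sqr_ge0 (`|k| - C).
  by rewrite /J; lra.
have hA : has_inf A by split; [exists (J 0), 0|exists (- C ^+ 2)].
pose m := inf A.
have mJ k : m <= J k by apply: ge_inf; [exists (- C ^+ 2)|exists k].
have /choice[k kP] n : exists k, J k < m + n.+1%:R^-1.
  have [|_ [k _ <-] kn] := @inf_adherent _ A n.+1%:R^-1 _ hA; first by rewrite invr_gt0.
  by exists k.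
(* Near-minimality of [k n] along the line [k n + t *: x] is a quadratic inequality in [t], and its
   discriminant bounds the failure of [k n] to represent [f]. *)
have CS n x : (ip (k n) x - f x) ^+ 2 <= n.+1%:R^-1 * `|x| ^+ 2.
  apply: discr_le; last exact: sqr_ge0.
  move=> t; have := mJ (k n + t *: x); have := kP n; rewrite /J.
  rewrite fD fZ -!(ipxx hip).
  rewrite !(ipDl hip, ipDr hip, ipZl hip, ipZr hip) (ipC hip x).
  move: (_^-1) (ip (k n) (k n)) (ip (k n) x) (ip x x) (f (k n)) (f x) => a b c d p q; lra.
have kC : forall e : R, 0 < e -> exists K, forall p q, (K <= p)%N -> (K <= q)%N -> `|k p - k q| < e.
  (* By the parallelogram law the squared distance is [2 * J (k p) + 2 * J (k q)] minus 4 times [J]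
     at the midpoint, hence below [2 / p.+1 + 2 / q.+1]. *)
  move=> e e0; have e2 : 0 < e ^+ 2 / 4 by rewrite divr_gt0// exprn_gt0.
  have [K KP] := inv_succ_lt e2; exists K => p q Kp Kq.
  rewrite -(@ltr_pXn2r _ 2)// ?nnegrE ?(ltW e0)// parallelogram.
  have := mJ (2^-1 *: (k p + k q)); have := kP p; have := kP q; have := KP p Kp; have := KP q Kq.
  rewrite /J normrZ exprMn ger0_norm ?invr_ge0// fZ fD.
  move: (q.+1%:R^-1) (p.+1%:R^-1) (e ^+ 2) (`|k p| ^+ 2) (`|k q| ^+ 2) (`|k p + k q| ^+ 2) (f (k p)) (f (k q)).
  by move=> a b c s t u v w; lra.
have [h kh] := cauchy_seq_cvg kC.
exists h => x; rewrite -/(f x); apply/eqP; rewrite -subr_eq0 -normr_le0; apply/ler_addgt0Pr => e e0; rewrite add0r.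
have x1 : 0 < `|x| + 1 by rewrite ltr_wpDl.
have e2 : 0 < e / 2 / (`|x| + 1) by rewrite !divr_gt0.
have [K1 K1P] := (cvg_seqP _ _).1 kh _ e2.
have [|K2 K2P] := @inv_succ_lt R ((e / 2 / (`|x| + 1)) ^+ 2); first by rewrite exprn_gt0.
pose n := maxn K1 K2.
have -> : ip h x - f x = (ip (k n) x - f x) - ip (k n - h) x by rewrite (ipBl hip); ring.
rewrite (le_trans (ler_normB _ _))// [leRHS]splitr lerD//.
  rewrite -(@ler_pXn2r _ 2)// ?nnegrE ?divr_ge0 ?(ltW e0)//.
  rewrite real_normK ?num_real// (le_trans (CS n x))//.
  apply: le_trans (_ : (e / 2 / (`|x| + 1)) ^+ 2 * (`|x| + 1) ^+ 2 <= _).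
    apply: ler_pM; rewrite ?invr_ge0 ?sqr_ge0//; first by rewrite ltW// K2P// leq_maxr.
    by rewrite ler_pXn2r ?nnegrE ?lerDl// ltW.
  by rewrite -exprMn divfK// gt_eqF.
apply: le_trans (ip_CS hip _ _) _.
apply: le_trans (_ : e / 2 / (`|x| + 1) * (`|x| + 1) <= _); last by rewrite divfK// gt_eqF.
by apply: ler_pM => //; [rewrite ltW// K1P// leq_maxl|rewrite lerDl].
Qed.

End riesz.

(** * Finite rank operators and the gamma norm *)

Lemma filter_sum_lt {R : realType} {T : Type} (F : set_system T) {FF : Filter F}
    N (a : nat -> T -> R) :
  (forall i, (i < N)%N -> forall e, 0 < e -> F [set t | a i t < e]) ->
  forall e, 0 < e -> F [set t | \sum_(i < N) a i t < e].
Proof.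
elim: N => [|N IH] aF e e0.
  by apply: filterS filterT => t _ /=; rewrite big_ord0.
have e2 : 0 < e / 2 by rewrite divr_gt0.
have h1 := IH (fun i iN => aF i (leqW iN)) _ e2.
apply: filterS (filterI h1 (aF N (ltnSn N) _ e2)) => t [/= s1 s2].
by rewrite big_ord_recr/= (splitr e) ltrD.
Qed.

Lemma filter_inftyP (P : set nat) : \oo P <-> exists K, forall n, (K <= n)%N -> P n.
Proof.
split=> [[K _ KP]|[K KP]]; first by exists K => n Kn; exact: KP.
by exists K => // n Kn; exact: KP.
Qed.

Section projections.
Context {R : realType} {H : normedModType R}.
Variable ip : H -> H -> R.
Hypothesis hip : inner_product ip.
Implicit Types (h g : nat -> H).

(** Composition on the right with such a map only moves the coefficient vectors in [H] and does not
    increase the norm. Projections and differences of nested projections are the instances used. *)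
Definition selfadjoint_contraction (W : H -> H) :=
  [/\ is_linear W, forall x y, ip (W x) y = ip x (W y) & forall x, `|W x| <= `|x|].

Lemma proj_linear N h : is_linear (oproj ip N h).
Proof.
move=> a u v; rewrite /oproj scaler_sumr -big_split; apply: eq_bigr => i _ /=.
by rewrite (ipDl hip) (ipZl hip) scalerDl scalerA.
Qed.

Lemma proj_sym N h x y : ip (oproj ip N h x) y = ip x (oproj ip N h y).
Proof.
rewrite (ipC hip x) !(ip_proj hip); apply: eq_bigr => i _; exact: mulrC.
Qed.

Lemma norm_proj N h x : onb ip N h ->
  `|oproj ip N h x| ^+ 2 = \sum_(i < N) ip x (h i) * ip x (h i).
Proof. by move=> oh; rewrite (norm_lincomb_onb hip (fun i => ip x (h i))). Qed.

Lemma proj_idem N h x : onb ip N h -> oproj ip N h (oproj ip N h x) = oproj ip N h x.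
Proof.
by move=> oh; apply: eq_bigr => i _; rewrite (ip_proj_onb hip _ oh).
Qed.

Lemma proj_contraction N h : onb ip N h -> selfadjoint_contraction (oproj ip N h).
Proof.
move=> oh; split; [exact: proj_linear|exact: proj_sym|move=> x].
by rewrite -(@ler_pXn2r _ 2)// ?nnegrE// norm_proj// (bessel hip).
Qed.

Lemma norm_projB N h M g x : onb ip N h -> onb ip M g ->
  (forall i, (i < N)%N -> h i = oproj ip M g (h i)) ->
  `|oproj ip M g x - oproj ip N h x| ^+ 2 = `|oproj ip M g x| ^+ 2 - `|oproj ip N h x| ^+ 2.
Proof.
move=> oh og hg; set p := oproj ip M g x; set q := oproj ip N h x.
have pq : ip p q = `|q| ^+ 2.
  rewrite (ipC hip) (ip_proj hip) norm_proj//; apply: eq_bigr => i _.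
  by congr (_ * _); rewrite /p proj_sym -hg.
rewrite -!(ipxx hip) (ipBl hip) !(ipBr hip) (ipC hip q p) pq -(ipxx hip); ring.
Qed.

Lemma projB_contraction N h M g : onb ip N h -> onb ip M g ->
  (forall i, (i < N)%N -> h i = oproj ip M g (h i)) ->
  selfadjoint_contraction (fun x => oproj ip M g x - oproj ip N h x).
Proof.
move=> oh og hg; split.
- by move=> a u v; rewrite !proj_linear scalerBr opprD addrACA.
- by move=> x y; rewrite (ipBl hip) (ipBr hip) !proj_sym.
- move=> x; rewrite -(@ler_pXn2r _ 2)// ?nnegrE// norm_projB//.
  rewrite lerBlDr -[leLHS]addr0 lerD ?sqr_ge0//.
  have [_ _ ] := proj_contraction og => /(_ x).
  by rewrite ler_pXn2r ?nnegrE.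
Qed.

End projections.

Section finite_rank.
Context {R : realType} {H E : normedModType R}.
Variable ip : H -> H -> R.
Hypothesis hip : inner_product ip.
Implicit Types (h g v w : nat -> H) (x y z : nat -> E) (T U : H -> E).

Definition frop N v y : H -> E := fun k => \sum_(i < N) ip k (v i) *: y i.

(** The synthesis map from Euclidean space is a contraction. This is what remains of orthonormality
    under domination: [T^* x_i] is such a family when the [S^* x_i] are orthonormal. *)
Definition contr N v :=
  forall a : nat -> R, `|\sum_(j < N) a j *: v j| ^+ 2 <= \sum_(j < N) a j * a j.

Lemma onb_contr N h : onb ip N h -> contr N h.
Proof. by move=> oh a; rewrite (norm_lincomb_onb hip). Qed.

Lemma op_linear N v y : is_linear (frop N v y).
Proof.
move=> a u w; rewrite /frop scaler_sumr -big_split; apply: eq_bigr => i _ /=.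
by rewrite (ipDl hip) (ipZl hip) scalerDl scalerA.
Qed.

Lemma op_onb N h x i : onb ip N h -> (i < N)%N -> frop N h x (h i) = x i.
Proof.
move=> oh iN; rewrite /frop (bigD1 (Ordinal iN))//= oh// eqxx scale1r big1 ?addr0//.
by move=> j; rewrite -val_eqE/= eq_sym => /negbTE ij; rewrite oh// ij scale0r.
Qed.

Lemma op_span N v y M h : (forall i, (i < N)%N -> v i = oproj ip M h (v i)) ->
  frop N v y = frop M h (fun l => \sum_(i < N) ip (v i) (h l) *: y i).
Proof.
move=> vh; apply/funext => k; rewrite /frop.
under [RHS]eq_bigr do rewrite scaler_sumr.
rewrite exchange_big/=; apply: eq_bigr => i _.
rewrite [in LHS]vh// (ipC hip) (ip_proj hip) scaler_suml.
by apply: eq_bigr => l _; rewrite scalerA mulrC.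
Qed.

(** Evaluation at [h i] expresses [x] through [y] by the matrix [ip (h i) (v j)], a contraction by
    Bessel's inequality and [contr]. *)
Lemma nrm_op_le N v y M h x : onb ip M h -> contr N v -> frop M h x = frop N v y ->
  nrm M x <= nrm N y.
Proof.
move=> oh cv e; have -> : nrm M x = nrm M (fun i => \sum_(j < N) ip (h i) (v j) *: y j).
  rewrite /nrm; congr (Num.sqrt (fine _)); apply: eq_nsq => i iM.
  by rewrite -[LHS](op_onb x oh iM) e.
apply: (@nrm_contraction _ _ M N (fun i j => ip (h i) (v j)) y) => a; apply: le_trans (cv a).
apply: le_trans (bessel hip _ oh); apply: ler_sum => i _.
rewrite -expr2 (ip_suml hip N (fun j => a j *: v j)) le_eqVlt; apply/orP; left; apply/eqP.
by congr (_ ^+ 2); apply: eq_bigr => j _; rewrite (ipZl hip) mulrC (ipC hip).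
Qed.

Let ext (V : nmodType) N (x : 'I_N -> V) : nat -> V := fun i => oapp x 0 (insub i).

Let extE (V : nmodType) N (x : 'I_N -> V) (i : 'I_N) : ext x i = x i.
Proof. by rewrite /ext valK. Qed.

Let fr_repr_op T N (h : 'I_N -> H) (x : 'I_N -> E) : fr_repr ip T h x ->
  onb ip N (ext h) /\ T = frop N (ext h) (ext x).
Proof.
move=> [oh Tx]; split.
  move=> i j iN jN; have := oh (Ordinal iN) (Ordinal jN).
  by rewrite -(extE h (Ordinal iN)) -(extE h (Ordinal jN)).
by apply/funext => k; rewrite Tx; apply: eq_bigr => i _; rewrite !extE.
Qed.

Let op_fr_repr N h x : onb ip N h ->
  fr_repr ip (frop N h x) (fun i : 'I_N => h i) (fun i : 'I_N => x i).
Proof. by move=> oh; split => // i j; rewrite oh. Qed.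

Lemma finite_rankP T :
  finite_rank ip T <-> exists N h x, onb ip N h /\ T = frop N h x.
Proof.
split=> [[N [h [x /fr_repr_op[oh ->]]]]|[N [h [x [oh ->]]]]].
  by exists N, (ext h), (ext x).
by exists N, (fun i : 'I_N => h i), (fun i : 'I_N => x i); exact: op_fr_repr.
Qed.

(** The choice made by [xget] is immaterial: two orthonormal representations of one operator
    dominate each other by [nrm_op_le]. *)
Lemma fr_gnorm_onb N h x : onb ip N h -> fr_gnorm ip (frop N h x) = nrm N x.
Proof.
move=> oh; rewrite /fr_gnorm; set A := [set c | _].
have /(@xgetPex _ 0%E A) [M [h' [x' [/fr_repr_op[oh' e] ->]]]] : A !=set0.
  by exists (nsq N x), N, (fun i : 'I_N => h i), (fun i : 'I_N => x i); split => //; exact: op_fr_repr.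
have -> : gauss_sq x' = nsq M (ext x').
  by congr gauss_sq; apply/funext => i; rewrite extE.
apply/eqP; rewrite eq_le; apply/andP; split.
  exact: (nrm_op_le oh' (onb_contr oh) (esym e)).
exact: (nrm_op_le oh (onb_contr oh') e).
Qed.

Lemma onb_span (vs : seq H) : exists N h, onb ip N h /\ forall v : H, v \in vs -> v = oproj ip N h v.
Proof.
have [//|//|N [h [oh _ hv]]] := @gram_schmidt _ _ ip hip setT vs.
by exists N, h.
Qed.

Lemma finite_rank_op N v y : finite_rank ip (frop N v y).
Proof.
have [M [h [oh hv]]] := onb_span [seq v i | i <- iota 0 N].
apply/finite_rankP; exists M, h, (fun l => \sum_(i < N) ip (v i) (h l) *: y i); split => //.
by apply: op_span => i iN; apply: hv; apply: map_f; rewrite mem_iota.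
Qed.

Lemma finite_rank_common T U : finite_rank ip T -> finite_rank ip U ->
  exists N h x y, [/\ onb ip N h, T = frop N h x & U = frop N h y].
Proof.
move=> /finite_rankP[N [v [x [_ ->]]]] /finite_rankP[M [w [y [_ ->]]]].
have [L [h [oh hv]]] := onb_span ([seq v i | i <- iota 0 N] ++ [seq w i | i <- iota 0 M]).
exists L, h, (fun l => \sum_(i < N) ip (v i) (h l) *: x i), (fun l => \sum_(i < M) ip (w i) (h l) *: y i).
split => //; apply: op_span => i iN; apply: hv; rewrite mem_cat; apply/orP; [left|right];
  by apply: map_f; rewrite mem_iota.
Qed.

Lemma fr_gnorm_op_le N v y : contr N v -> fr_gnorm ip (frop N v y) <= nrm N y.
Proof.
move=> cv; have /finite_rankP[M [h [x [oh e]]]] := finite_rank_op N v y.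
by rewrite e fr_gnorm_onb//; exact: (nrm_op_le oh cv (esym e)).
Qed.

Lemma fr_gnorm_ge0 T : 0 <= fr_gnorm ip T. Proof. exact: sqrtr_ge0. Qed.

Lemma opD N h x y : (fun k => frop N h x k + frop N h y k) = frop N h (fun i => x i + y i).
Proof.
apply/funext => k; rewrite /frop -big_split; apply: eq_bigr => i _ /=.
by rewrite scalerDr.
Qed.

Lemma opZ N h x a : (fun k => a *: frop N h x k) = frop N h (fun i => a *: x i).
Proof.
apply/funext => k; rewrite /frop scaler_sumr; apply: eq_bigr => i _ /=.
by rewrite !scalerA mulrC.
Qed.

Lemma finite_rankD T U : finite_rank ip T -> finite_rank ip U ->
  finite_rank ip (fun k => T k + U k).
Proof.
move=> fT fU; have [N [h [x [y [oh -> ->]]]]] := finite_rank_common fT fU.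
by rewrite opD; exact: finite_rank_op.
Qed.

Lemma fr_gnormD T U : finite_rank ip T -> finite_rank ip U ->
  fr_gnorm ip (fun k => T k + U k) <= fr_gnorm ip T + fr_gnorm ip U.
Proof.
move=> fT fU; have [N [h [x [y [oh -> ->]]]]] := finite_rank_common fT fU.
by rewrite opD !fr_gnorm_onb//; exact: nrmD.
Qed.

Lemma finite_rankN T : finite_rank ip T -> finite_rank ip (fun k => - T k).
Proof.
move=> /finite_rankP[N [h [x [oh ->]]]].
rewrite (_ : (fun k => _) = (fun k => -1 *: frop N h x k)); last by apply/funext => k; rewrite scaleN1r.
by rewrite opZ; exact: finite_rank_op.
Qed.

Lemma fr_gnormN T : finite_rank ip T -> fr_gnorm ip (fun k => - T k) = fr_gnorm ip T.
Proof.
move=> /finite_rankP[N [h [x [oh ->]]]].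
rewrite (_ : (fun k => _) = (fun k => -1 *: frop N h x k)); last by apply/funext => k; rewrite scaleN1r.
by rewrite opZ !fr_gnorm_onb// nrmZ normrN1 mul1r.
Qed.

Lemma finite_rankB T U : finite_rank ip T -> finite_rank ip U -> finite_rank ip (fsub T U).
Proof. by move=> fT fU; exact: finite_rankD fT (finite_rankN fU). Qed.

Lemma fr_gnormC T U : finite_rank ip T -> finite_rank ip U ->
  fr_gnorm ip (fsub T U) = fr_gnorm ip (fsub U T).
Proof.
move=> fT fU; rewrite -(fr_gnormN (finite_rankB fU fT)); congr (fr_gnorm ip).
by apply/funext => k; rewrite /fsub opprB.
Qed.

Lemma fr_gnorm_tri U T V : finite_rank ip T -> finite_rank ip U -> finite_rank ip V ->
  fr_gnorm ip (fsub T V) <= fr_gnorm ip (fsub T U) + fr_gnorm ip (fsub U V).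
Proof.
move=> fT fU fV.
rewrite (_ : fsub T V = fun k => fsub T U k + fsub U V k); last first.
  by apply/funext => k; rewrite /fsub addrA subrK.
by apply: fr_gnormD; exact: finite_rankB.
Qed.

Lemma fr_gnormB T U : finite_rank ip T -> finite_rank ip U ->
  `|fr_gnorm ip T - fr_gnorm ip U| <= fr_gnorm ip (fsub T U).
Proof.
have E1 (A B : H -> E) : finite_rank ip A -> finite_rank ip B ->
    fr_gnorm ip A - fr_gnorm ip B <= fr_gnorm ip (fsub A B).
  move=> fA fB; rewrite lerBlDr {1}(_ : A = fun k => fsub A B k + B k).
    by apply: fr_gnormD => //; exact: finite_rankB.
  by apply/funext => k; rewrite /fsub subrK.
move=> fT fU; rewrite ler_norml E1// andbT lerNl opprB fr_gnormC//.
exact: E1.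
Qed.

Lemma op_zero v y : frop 0 v y = fun=> 0.
Proof. by apply/funext => k; rewrite /frop big_ord0. Qed.

Lemma fr_gnorm0 : fr_gnorm ip (fun=> 0 : E) = 0.
Proof.
rewrite -(op_zero (fun=> 0) (fun=> 0)) fr_gnorm_onb//.
by rewrite /nrm /nsq /gauss_sq /= big_ord0 normr0 expr0n sqrtr0.
Qed.

(** Crude, but with the number of terms fixed it turns convergence of the finitely many
    coefficients, in [H] or in [E], into convergence in norm. *)
Lemma fr_gnorm_op_sum N v y :
  fr_gnorm ip (frop N v y) <= \sum_(i < N) Num.sqrt (@normal_sqr R) * (`|v i| * `|y i|).
Proof.
elim: N => [|N IH]; first by rewrite op_zero fr_gnorm0 big_ord0.
have -> : frop N.+1 v y = fun k => frop N v y k + frop 1 (fun=> v N) (fun=> y N) k.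
  by apply/funext => k; rewrite /frop big_ord_recr big_ord1.
apply: le_trans (fr_gnormD (finite_rank_op _ _ _) (finite_rank_op _ _ _)) _.
rewrite big_ord_recr lerD//=.
have [v0|v0] := eqVneq (v N) 0.
  rewrite (_ : frop 1 _ _ = fun=> 0) ?fr_gnorm0 ?mulr_ge0//.
  by apply/funext => k; rewrite /frop big_ord1 v0 (ipC hip) (ip0l hip) scale0r.
have v1 : `|v N| != 0 by rewrite normr_eq0.
rewrite (_ : frop 1 _ _ = frop 1 (fun=> `|v N|^-1 *: v N) (fun=> `|v N| *: y N)).
  rewrite fr_gnorm_onb ?nrm1 ?normrZ ?normr_id//.
  move=> [|//] [|//] _ _; rewrite (ipZl hip) (ipZr hip) (ipxx hip) expr2 mulKf// mulVf//.
apply/funext => k; rewrite /frop !big_ord1 (ipZr hip) scalerA; congr (_ *: _).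
by rewrite mulrAC mulVf// mul1r.
Qed.

(** By Bessel the coefficients of [k] divided by its norm form a row of norm at most 1, so
    [nrm_lincomb_le] applies. *)
Lemma fr_gnorm_bound T k : finite_rank ip T ->
  Num.sqrt (@normal_sqr R) * `|T k| <= fr_gnorm ip T * `|k|.
Proof.
move=> /finite_rankP[N [h [x [oh ->]]]]; rewrite fr_gnorm_onb//.
have [->|k0] := eqVneq k 0.
  by rewrite (is_linear0 (@op_linear N h x)) !normr0 !mulr0.
have k1 : 0 < `|k| by rewrite normr_gt0.
rewrite -ler_pdivrMr// -mulrA.
have -> : `|frop N h x k| / `|k| = `|\sum_(j < N) (`|k|^-1 * ip k (h j)) *: x j|.
  rewrite -[X in _ = X]/(`|_|) mulrC -[X in X * _](@ger0_norm _ `|k|^-1) ?invr_ge0// -normrZ.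
  rewrite /frop scaler_sumr; congr `|_|; apply: eq_bigr => j _; rewrite scalerA//.
apply: (@nrm_lincomb_le _ _ N x (fun j => `|k|^-1 * ip k (h j))).
rewrite (_ : \sum_(j < N) _ = `|k| ^- 2 * \sum_(j < N) ip k (h j) * ip k (h j)); last first.
  by rewrite mulr_sumr; apply: eq_bigr => j _; rewrite mulrACA -expr2 exprVn.
by rewrite ler_pdivrMl ?exprn_gt0// mulr1 (bessel hip).
Qed.

Lemma finite_rank_linear T : finite_rank ip T -> is_linear T.
Proof. by move=> /finite_rankP[N [h [x [_ ->]]]]; exact: op_linear. Qed.

Lemma comp_op N h x W : selfadjoint_contraction ip W ->
  (fun k => frop N h x (W k)) = frop N (fun i => W (h i)) x.
Proof.
by move=> [_ Ws _]; apply/funext => k; apply: eq_bigr => i _; rewrite Ws.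
Qed.

Lemma finite_rank_comp T W : finite_rank ip T -> selfadjoint_contraction ip W ->
  finite_rank ip (fun k => T (W k)).
Proof.
move=> /finite_rankP[N [h [x [oh ->]]]] cW; rewrite comp_op//; exact: finite_rank_op.
Qed.

Lemma fr_gnorm_comp T W : finite_rank ip T -> selfadjoint_contraction ip W ->
  fr_gnorm ip (fun k => T (W k)) <= fr_gnorm ip T.
Proof.
move=> /finite_rankP[N [h [x [oh ->]]]] cW; rewrite comp_op// [leRHS]fr_gnorm_onb//.
apply: fr_gnorm_op_le => a; have [lW _ nW] := cW.
rewrite -(is_linear_lincomb N a h lW) -(norm_lincomb_onb hip a oh).
by rewrite ler_pXn2r ?nnegrE.
Qed.

Lemma op_proj T N h : is_linear T ->
  (fun k => T (oproj ip N h k)) = frop N h (fun i => T (h i)).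
Proof.
move=> lT; apply/funext => k.
by rewrite /oproj (is_linear_lincomb N (fun i => ip k (h i)) h lT).
Qed.

Definition fr_cauchy (Tk : nat -> H -> E) := forall e : R, 0 < e ->
  exists K, forall m n, (K <= m)%N -> (K <= n)%N -> fr_gnorm ip (fsub (Tk m) (Tk n)) < e.

(* If U_n = U_n P with P a finite-dimensional projection, then U_m P -> 0 in
   norm, so that |U_n| <= |(U_n - U_m) P| + |U_m P| is small. *)
Lemma fr_gnorm_closable (Uk : nat -> H -> E) : (forall k, finite_rank ip (Uk k)) ->
  fr_cauchy Uk -> (forall k, (fun n => Uk n k) @ \oo --> (0 : E)) ->
  (fun n => fr_gnorm ip (Uk n)) @ \oo --> (0 : R).
Proof.
move=> fU cU U0; apply/(@cvg_seqP R R^o) => e e0.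
have e2 : 0 < e / 2 by rewrite divr_gt0.
have [K KP] := cU _ e2; exists K => n Kn; rewrite subr0 ger0_norm ?fr_gnorm_ge0//.
suff : fr_gnorm ip (Uk n) <= e / 2 by move=> h; lra.
have /finite_rankP[N [h [x [oh Un]]]] := fU n.
apply/ler_addgt0Pr => d d0.
have c0 : 0 < Num.sqrt (@normal_sqr R) + 1 by rewrite ltr_wpDl.
have /filter_inftyP[L LP] : \oo [set m | \sum_(i < N) `|Uk m (h i)| < d / (Num.sqrt (@normal_sqr R) + 1)].
  apply: (@filter_sum_lt R nat \oo _ N (fun i m => `|Uk m (h i)|)); last by rewrite divr_gt0.
  move=> i _ r r0; apply/filter_inftyP; have [M MP] := (cvg_seqP _ _).1 (U0 (h i)) r r0.
  by exists M => m Mm /=; have := MP m Mm; rewrite subr0.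
pose m := maxn K L.
have cP := proj_contraction hip oh.
have -> : Uk n = fun k => fsub (Uk n) (Uk m) (oproj ip N h k) + Uk m (oproj ip N h k).
  apply/funext => k; rewrite /fsub subrK Un.
  have /(congr1 (fun f => f k))/= -> := op_proj N h (@op_linear N h x).
  by apply: eq_bigr => i _; rewrite op_onb.
have fB := finite_rankB (fU n) (fU m).
apply: le_trans (fr_gnormD (finite_rank_comp fB cP) (finite_rank_comp (fU m) cP)) _.
apply: lerD.
  by apply: le_trans (fr_gnorm_comp fB cP) _; rewrite ltW// KP// leq_maxl.
rewrite op_proj; last exact: finite_rank_linear.
apply: le_trans (fr_gnorm_op_sum _ _ _) _.
rewrite -mulr_sumr.
have hi i : (i < N)%N -> `|h i| = 1.
  by move=> iN; apply/eqP; rewrite -sqrp_eq1// -(ipxx hip) oh// eqxx.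
rewrite (_ : \sum_(i < N) _ = \sum_(i < N) `|Uk m (h i)|); last first.
  by apply: eq_bigr => i _; rewrite hi// mul1r.
apply: le_trans (_ : (Num.sqrt (@normal_sqr R) + 1) * (d / (Num.sqrt (@normal_sqr R) + 1)) <= _).
  by apply: ler_pM => //; [exact: sumr_ge0|rewrite lerDl|rewrite ltW// LP// leq_maxr].
by rewrite mulrC divfK// gt_eqF.
Qed.

Lemma gamma_approx_sub Tk T Uk U : gamma_approx ip Tk T -> gamma_approx ip Uk U ->
  gamma_approx ip (fun n => fsub (Tk n) (Uk n)) (fsub T U).
Proof.
move=> [fT cT vT] [fU cU vU]; split.
- by move=> k; exact: finite_rankB.
- move=> e e0; have e2 : 0 < e / 2 by rewrite divr_gt0.
  have [K1 P1] := cT _ e2; have [K2 P2] := cU _ e2; exists (maxn K1 K2) => m n.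
  rewrite !geq_max => /andP[m1 m2] /andP[n1 n2].
  rewrite (_ : fsub _ _ = fun k => fsub (Tk m) (Tk n) k + fsub (Uk n) (Uk m) k).
    apply: le_lt_trans (fr_gnormD (finite_rankB _ _) (finite_rankB _ _)) _ => //.
    by rewrite (splitr e) ltrD ?P1 ?P2.
  by apply/funext => k; rewrite /fsub opprB addrACA [RHS]addrACA; congr (_ + _); rewrite addrC.
- by move=> k; apply: cvgB.
Qed.

(** The limit chosen in [gnorm] does not depend on the approximation: the difference of two
    approximations of [T] is Cauchy and tends to 0 pointwise, hence in norm by
    [fr_gnorm_closable]. *)
Lemma gnorm_cvg Tk T : gamma_approx ip Tk T ->
  (fun n => fr_gnorm ip (Tk n)) @ \oo --> Defs.gnorm ip T.
Proof.
move=> aT; have [fT cT vT] := aT.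
have [c cc] : exists c : R^o, (fun n => fr_gnorm ip (Tk n)) @ \oo --> c.
  apply: cauchy_seq_cvg => e e0; have [K KP] := cT e e0; exists K => m n Km Kn.
  by apply: le_lt_trans (fr_gnormB (fT m) (fT n)) _; exact: KP.
rewrite /Defs.gnorm; set A := [set c | _].
have /(@xgetPex _ 0 A) [Uk [aU cU]] : A !=set0 by exists c, Tk.
set d := xget 0 A in cU *.
have [fU _ _] := aU.
have [fB cB vB] := gamma_approx_sub aT aU.
have z : (fun n => fr_gnorm ip (fsub (Tk n) (Uk n))) @ \oo --> (0 : R).
  by apply: fr_gnorm_closable => // k; have := vB k; rewrite /fsub subrr.
apply/(@cvg_seqP R R^o) => e e0; have e2 : 0 < e / 2 by rewrite divr_gt0.
have [K1 P1] := (@cvg_seqP R R^o _ _).1 z _ e2.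
have [K2 P2] := (@cvg_seqP R R^o _ _).1 cU _ e2.
exists (maxn K1 K2) => n; rewrite geq_max => /andP[n1 n2].
have := P1 n n1; have := P2 n n2; rewrite subr0 (ger0_norm (fr_gnorm_ge0 _)) => h1 h2.
rewrite (le_lt_trans (ler_distD (fr_gnorm ip (Uk n)) _ _))// (splitr e) ltrD//.
by apply: le_lt_trans (fr_gnormB (fT n) (fU n)) _.
Qed.

Lemma gnorm_le Tk T c K : gamma_approx ip Tk T ->
  (forall n, (K <= n)%N -> fr_gnorm ip (Tk n) <= c) -> Defs.gnorm ip T <= c.
Proof.
move=> /gnorm_cvg/(@cvg_seqP R R^o) g Kc; apply/ler_addgt0Pr => e e0.
have [L LP] := g e e0; have := Kc _ (leq_maxl K L); have := LP _ (leq_maxr K L).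
by rewrite ltr_norml => /andP[]; lra.
Qed.

Lemma gnorm_ge0 T : in_gamma ip T -> 0 <= Defs.gnorm ip T.
Proof.
move=> [Tk /gnorm_cvg/(@cvg_seqP R R^o) g]; apply/ler_addgt0Pr => e e0.
have [L LP] := g e e0; have := LP L (leqnn L); have := fr_gnorm_ge0 (Tk L).
by rewrite ltr_norml => ? /andP[]; lra.
Qed.

Lemma gnorm_bound T k : in_gamma ip T ->
  Num.sqrt (@normal_sqr R) * `|T k| <= Defs.gnorm ip T * `|k|.
Proof.
move=> [Tk aT]; have [fT cT vT] := aT; have g := gnorm_cvg aT.
apply: (@ler_cvg_to _ \oo _ _ (fun n => Num.sqrt (@normal_sqr R) * `|Tk n k|)
  (fun n => fr_gnorm ip (Tk n) * `|k|)).
- by apply: cvgMr; apply: cvg_norm; exact: vT.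
- by apply: cvgMl.
- by apply/filter_inftyP; exists 0%N => n _; exact: fr_gnorm_bound.
Qed.

Lemma in_gamma_linear T : in_gamma ip T -> is_linear T.
Proof.
move=> [Tk [fT _ vT]] a u v.
rewrite -(cvg_lim (@norm_hausdorff _ _) (vT (a *: u + v))).
apply: cvg_lim; first exact: norm_hausdorff.
rewrite (_ : (fun n => _) = (fun n => a *: Tk n u + Tk n v)); last first.
  by apply/funext => n; exact: (finite_rank_linear (fT n)).
by apply: cvgD; [apply: cvgZr; exact: vT|exact: vT].
Qed.

Lemma sqrt_normal_sqr_gt0 : 0 < Num.sqrt (@normal_sqr R).
Proof. by rewrite sqrtr_gt0 normal_sqr_gt0. Qed.

Lemma in_gamma_bounded_linear T : in_gamma ip T -> bounded_linear T.
Proof.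
move=> gT; apply/bounded_linearP; split; first exact: in_gamma_linear.
have c0 := sqrt_normal_sqr_gt0.
exists ((Defs.gnorm ip T + 1) / Num.sqrt (@normal_sqr R)); split.
  by rewrite divr_gt0// ltr_wpDl// gnorm_ge0.
move=> k; rewrite mulrAC ler_pdivlMr// mulrC.
by apply: le_trans (gnorm_bound k gT) _; rewrite ler_wpM2r// lerDl.
Qed.

Lemma in_gammaB T U : in_gamma ip T -> in_gamma ip U -> in_gamma ip (fsub T U).
Proof.
by move=> [Tk aT] [Uk aU]; exists (fun n => fsub (Tk n) (Uk n)); exact: gamma_approx_sub.
Qed.

End finite_rank.

(** * Domination *)

Section adjoint.
Context {R : realType} {H E : completeNormedModType R}.
Variable ip : H -> H -> R.
Hypothesis hip : inner_product ip.
Implicit Types (T : H -> E) (xs ys : E -> R^o).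

(** Riesz representation provides the vector, so the default 0 in [adj] is not reached. *)
Lemma adjP T xs k : bounded_linear T -> dual_elt xs -> ip (adj ip T xs) k = xs (T k).
Proof.
move=> /bounded_linearP[lT [C [C0 CP]]] /bounded_linearP[lx [D [D0 DP]]].
have [h hP] : exists h, forall k, ip h k = xs (T k).
  apply: (riesz hip); apply/bounded_linearP; split; first by move=> a u v; rewrite lT lx.
  exists (D * C); split; first exact: mulr_gt0.
  move=> x; apply: le_trans (DP _) _; rewrite -mulrA ler_pM2l//.
rewrite /adj; set A := [set _ | _].
by have /(@xgetPex _ 0 A) : A !=set0 by exists h.
Qed.

Lemma dual_comb a xs ys : dual_elt xs -> dual_elt ys ->
  dual_elt (fun e => a * xs e + ys e : R^o).
Proof.
move=> /bounded_linearP[lx [C [C0 CP]]] /bounded_linearP[ly [D [D0 DP]]].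
apply/bounded_linearP; split.
  move=> b u v; rewrite lx ly -![_ *: _]/(_ * _); ring.
exists (`|a| * C + D); split; first by rewrite ltr_wpDl// mulr_ge0// ltW.
move=> x; rewrite mulrDl; apply: le_trans (ler_normD _ _) _; apply: lerD => //.
by rewrite normrM -mulrA ler_wpM2l.
Qed.

Lemma adj_comb T a xs ys : bounded_linear T -> dual_elt xs -> dual_elt ys ->
  adj ip T (fun e => a * xs e + ys e) = a *: adj ip T xs + adj ip T ys.
Proof.
move=> bT dx dy; apply: (ip_eq hip) => k.
rewrite adjP//; last exact: dual_comb.
by rewrite (ipDl hip) (ipZl hip) !adjP.
Qed.

Lemma dual_zero : dual_elt ((fun=> 0) : E -> R^o).
Proof.
apply/bounded_linearP; split; first by move=> a u v; rewrite scaler0 addr0.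
by exists 1; split => // x; rewrite normr0 mul1r.
Qed.

Definition dsum N (a : nat -> R) (xs : nat -> E -> R^o) : E -> R^o :=
  fun e => \sum_(i < N) a i * xs i e.

Lemma dsumS N a (xs : nat -> E -> R^o) : dsum N.+1 a xs = (fun e => a N * xs N e + dsum N a xs e).
Proof. by apply/funext => e; rewrite /dsum big_ord_recr addrC. Qed.

Lemma dual_dsum N a (xs : nat -> E -> R^o) : (forall i, (i < N)%N -> dual_elt (xs i)) -> dual_elt (dsum N a xs).
Proof.
elim: N => [_|N IH dx].
  by rewrite (_ : dsum _ _ _ = fun=> 0); [exact: dual_zero|apply/funext => e; rewrite /dsum big_ord0].
rewrite dsumS; apply: dual_comb; first exact: dx.
by apply: IH => i iN; apply: dx; exact: ltnW.
Qed.

Lemma adj_dsum N a (xs : nat -> E -> R^o) T : bounded_linear T -> (forall i, (i < N)%N -> dual_elt (xs i)) ->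
  adj ip T (dsum N a xs) = \sum_(i < N) a i *: adj ip T (xs i).
Proof.
move=> bT dx; apply: (ip_eq hip) => k; rewrite adjP//; last exact: dual_dsum.
rewrite (ip_suml hip N (fun i => a i *: adj ip T (xs i))); apply: eq_bigr => i _.
by rewrite (ipZl hip) adjP//; exact: dx.
Qed.

(** Test the difference [a] of the adjoints against itself: its squared norm is [xs] applied to
    [(T - U) a]. This continuity of [T |-> T^* xs] gives the forward implication. *)
Lemma adj_dist T U xs C : in_gamma ip T -> in_gamma ip U -> dual_elt xs ->
  0 <= C -> (forall e, `|xs e| <= C * `|e|) ->
  Num.sqrt (@normal_sqr R) * `|adj ip T xs - adj ip U xs| <= C * Defs.gnorm ip (fsub T U).
Proof.
move=> gT gU dx C0 CP; set a := adj ip T xs - adj ip U xs.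
have gTU := in_gammaB hip gT gU.
have bT := in_gamma_bounded_linear hip gT; have bU := in_gamma_bounded_linear hip gU.
have [->|a0] := eqVneq a 0; first by rewrite normr0 mulr0 mulr_ge0// (gnorm_ge0 hip).
have a1 : 0 < `|a| by rewrite normr_gt0.
have lx : is_linear xs by case: dx.
rewrite -(ler_pM2r a1) -mulrA -expr2 -(ipxx hip) {2}/a (ipC hip) (ipBl hip) !adjP//.
rewrite -(is_linearB _ _ lx) -mulrA.
have aE : ip a a = xs (fsub T U a) by rewrite {1}/a (ipBl hip) !adjP// -(is_linearB _ _ lx).
apply: le_trans (_ : Num.sqrt (@normal_sqr R) * (C * `|fsub T U a|) <= _).
  by apply: ler_wpM2l => //; apply: le_trans (CP _); exact: ler_norm.
by rewrite mulrCA; apply: ler_wpM2l => //; exact: (gnorm_bound hip).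
Qed.

End adjoint.

Section domination.
Context {R : realType} {H E : completeNormedModType R}.
Variable ip : H -> H -> R.
Hypothesis hip : inner_product ip.
Variable S : H -> E.
Hypothesis hS : in_gamma ip S.
Implicit Types (T : H -> E) (xs ys zs : nat -> E -> R^o) (N M : nat).

Notation A z := (adj ip S z).
Notation c := (Num.sqrt (@normal_sqr R)).

Let bS : bounded_linear S. Proof. exact: (in_gamma_bounded_linear hip). Qed.
Let lS : is_linear S. Proof. by case: bS. Qed.
Let c0 : 0 < c. Proof. exact: sqrt_normal_sqr_gt0. Qed.

Definition dominated T := bounded_linear T /\
  forall z : E -> R^o, dual_elt z -> `|adj ip T z| <= `|adj ip S z|.

Definition system N xs :=
  (forall i, (i < N)%N -> dual_elt (xs i)) /\ onb ip N (fun i => A (xs i)).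

(** Inclusion of the spans of the [S^*]-images, not of the functionals: functionals with the same
    image under [S^*] also agree under [T^*] for every dominated [T]. *)
Definition refines N xs M ys :=
  forall i, (i < N)%N -> A (xs i) = oproj ip M (fun l => A (ys l)) (A (xs i)).

(* For T = S this is S P with P the projection onto the span of the S^* xs i. *)
Definition truncation N xs T : H -> E := fun k => \sum_(i < N) xs i (T k) *: S (A (xs i)).

Lemma system_span N zs : (forall i, (i < N)%N -> dual_elt (zs i)) ->
  exists M ys, system M ys /\ refines N zs M ys.
Proof.
move=> dz.
have [||M [h [oh Dh hv]]] := @gram_schmidt _ _ ip hip [set A z | z in [set z : E -> R^o | dual_elt z]]
  [seq A (zs i) | i <- iota 0 N].
- move=> a _ _ [x dx <-] [y dy <-]; exists (fun e => a * x e + y e); first exact: dual_comb.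
  exact: adj_comb.
- by move=> v /mapP[i]; rewrite mem_iota add0n => /andP[_ iN] ->; exists (zs i) => //; exact: dz.
have /choice[ys ysP] i : exists y : E -> R^o, (i < M)%N -> dual_elt y /\ A y = h i.
  have [iM|] := boolP (i < M)%N; last by exists (fun=> 0).
  by have [y dy yh] := Dh i iM; exists y.
have yh i : (i < M)%N -> A (ys i) = h i by move=> iM; case: (ysP i iM).
exists M, ys; split; first split.
- by move=> i iM; case: (ysP i iM).
- by move=> i j iM jM /=; rewrite !yh// oh.
- move=> i iN; rewrite [LHS]hv; last by apply: map_f; rewrite mem_iota.
  by apply: eq_bigr => l _ /=; rewrite yh.
Qed.

Lemma truncationE N xs T : system N xs -> bounded_linear T ->
  truncation N xs T = frop ip N (fun i => adj ip T (xs i)) (fun i => S (A (xs i))).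
Proof.
move=> [dx _] bT; apply/funext => k; apply: eq_bigr => i _.
by rewrite (ipC hip) (adjP hip)//; exact: dx.
Qed.

Lemma finite_rank_truncation N xs T : system N xs -> bounded_linear T ->
  finite_rank ip (truncation N xs T).
Proof. by move=> sx bT; rewrite truncationE//; exact: finite_rank_op. Qed.

Lemma truncation_proj N xs k : system N xs ->
  truncation N xs S k = S (oproj ip N (fun i => A (xs i)) k).
Proof.
move=> sx; rewrite truncationE//.
by rewrite (is_linear_lincomb N (fun i => ip k (A (xs i))) (fun i => A (xs i)) lS).
Qed.

Let dominated_eq T z : dominated T -> dual_elt z -> A z = 0 -> adj ip T z = 0.
Proof.
move=> [_ dT] dz Az; apply/eqP; rewrite -normr_le0; apply: le_trans (dT z dz) _.
by rewrite Az normr0.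
Qed.

(** The functional [xs i] minus its expansion in the [ys l] is annihilated by [S^*], hence by [T^*];
    so the expansion coefficients found for [S] serve every dominated [T]. *)
Let adj_refines T N xs M ys i : dominated T -> system N xs -> system M ys ->
  refines N xs M ys -> (i < N)%N ->
  adj ip T (xs i) = \sum_(l < M) ip (A (xs i)) (A (ys l)) *: adj ip T (ys l).
Proof.
move=> dT [dx _] [dy _] xy iN; have [bT _] := dT.
pose b l := ip (A (xs i)) (A (ys l)).
have dz := dual_comb (-1) (dual_dsum b dy) (dx i iN).
have Ez U : bounded_linear U -> adj ip U (fun e => -1 * dsum M b ys e + xs i e) =
    adj ip U (xs i) - \sum_(l < M) b l *: adj ip U (ys l).
  move=> bU; rewrite (adj_comb hip _ bU (dual_dsum b dy) (dx i iN)) (adj_dsum hip _ bU dy).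
  by rewrite scaleN1r addrC.
apply/eqP; rewrite -subr_eq0 -(Ez T bT); apply/eqP/(dominated_eq dT dz).
by rewrite (Ez S bS) {1}(xy i iN) subrr.
Qed.

(* The two differences have the same coefficient vectors in E, and domination
   makes l |-> T^* ys l a contraction. *)
Lemma truncation_dominated T N xs M ys : dominated T -> system N xs -> system M ys ->
  refines N xs M ys ->
  fr_gnorm ip (fsub (truncation M ys T) (truncation N xs T)) <=
  fr_gnorm ip (fsub (truncation M ys S) (truncation N xs S)).
Proof.
move=> dT sx sy xy.
pose y l := S (A (ys l)) - \sum_(i < N) ip (A (xs i)) (A (ys l)) *: S (A (xs i)).
have EU U : dominated U -> fsub (truncation M ys U) (truncation N xs U) =
    frop ip M (fun l => adj ip U (ys l)) y.
  move=> dU; have [bU _] := dU; apply/funext => k; rewrite /fsub !truncationE// /frop.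
  under [RHS]eq_bigr do rewrite scalerBr scaler_sumr.
  rewrite sumrB; congr (_ - _); rewrite exchange_big/=; apply: eq_bigr => i _.
  rewrite (adj_refines dU sx sy xy (ltn_ord i)).
  rewrite (ip_sumr hip M (fun l => ip (A (xs i)) (A (ys l)) *: adj ip U (ys l))) scaler_suml.
  by apply: eq_bigr => l _; rewrite (ipZr hip) scalerA mulrC.
rewrite !EU//; have [dy oy] := sy; rewrite [leRHS](fr_gnorm_onb hip)//.
apply: (fr_gnorm_op_le hip) => a; have [bT dT'] := dT.
rewrite -(adj_dsum hip)// -(norm_lincomb_onb hip a oy) -(adj_dsum hip)//.
by rewrite ler_pXn2r ?nnegrE//; apply: dT'; exact: dual_dsum.
Qed.

(** A Cauchy condition along refinements, stated for [S] only; [truncation_dominated] passes it to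
    all dominated operators at once. *)
Definition tolerance N xs e := forall M ys, system M ys -> refines N xs M ys ->
  fr_gnorm ip (fsub (truncation M ys S) (truncation N xs S)) <= e.

(* Take a system that nearly maximises the mass it captures of a finite rank
   approximation of S. *)
Lemma tolerance_exists e : 0 < e -> exists N xs, system N xs /\ tolerance N xs e.
Proof.
move=> e0; have e3 : 0 < e / 3 by rewrite divr_gt0.
have [Sk [fS cS vS]] := hS.
have [K KP] := cS _ e3.
have /(finite_rankP)[L [h [x [oh SK]]]] := fS K.
pose Phi N xs := \sum_(i < L) `|oproj ip N (fun l => A (xs l)) (h i)| ^+ 2.
pose B := [set r | exists N xs, system N xs /\ r = Phi N xs].
have B0 : has_sup B.
  split; first by exists (Phi 0%N (fun=> fun=> 0)), 0%N, (fun=> fun=> 0); split.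
  exists (\sum_(i < L) `|h i| ^+ 2) => _ [N [xs [[_ ox] ->]]]; apply: ler_sum => i _.
  by rewrite ler_pXn2r ?nnegrE//; case: (proj_contraction hip ox).
pose X := \sum_(i < L) c * `|x i|.
have X0 : 0 <= X by apply: sumr_ge0 => i _; rewrite mulr_ge0// ltW.
(* Chosen so that [d * X <= e / 3], where [X] bounds the cost of the vectors [x i]; the slack
   [d ^+ 2] in the supremum becomes [|W (h i)| <= d] by Pythagoras. *)
pose d := e / 3 / (X + 1).
have d0 : 0 < d by rewrite divr_gt0// ltr_wpDl.
have [|_ [N [xs [sx ->]]] Phix] := sup_adherent (_ : 0 < d ^+ 2) B0; first by rewrite exprn_gt0.
exists N, xs; split => // M ys sy xy.
have [dx ox] := sx; have [dy oy] := sy.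
pose W k := oproj ip M (fun l => A (ys l)) k - oproj ip N (fun l => A (xs l)) k.
have cW : selfadjoint_contraction ip W by exact: (projB_contraction hip ox oy xy).
have [lW _ _] := cW.
have Wh i : (i < L)%N -> `|W (h i)| <= d.
  move=> iL; rewrite -(@ler_pXn2r _ 2)// ?nnegrE ?(ltW d0)//.
  apply: le_trans (_ : Phi M ys - Phi N xs <= _); last first.
    have : Phi M ys <= sup B by apply: ub_le_sup; [case: B0|exists M, ys].
    by move: Phix; lra.
  rewrite /Phi -sumrB (bigD1 (Ordinal iL))//= -(norm_projB hip _ ox oy xy) lerDl.
  by apply: sumr_ge0 => j _; rewrite -(norm_projB hip _ ox oy xy) sqr_ge0.
(* [W] factors through the projection onto the finer span, so [S - Sk m] composed with [W] has
   finite rank and is controlled at finitely many vectors. *)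
have WP k : W k = W (oproj ip M (fun l => A (ys l)) k).
  rewrite /W (proj_idem hip _ oy); congr (_ - _); apply: eq_bigr => i _; congr (_ *: _).
  by rewrite (proj_sym hip) -xy.
have /filter_inftyP[m0 m0P] : \oo [set m | \sum_(l < M) c * (`|A (ys l)| * `|fsub S (Sk m) (W (A (ys l)))|) < e / 3].
  apply: (@filter_sum_lt R nat \oo _ M
    (fun l m => c * (`|A (ys l)| * `|fsub S (Sk m) (W (A (ys l)))|))) => //.
  move=> l _ r r0; apply/filter_inftyP.
  pose D := c * `|A (ys l)| + 1.
  have D0 : 0 < D by rewrite ltr_wpDl// mulr_ge0// ltW.
  have [m1 m1P] := (cvg_seqP _ _).1 (vS (W (A (ys l)))) _ (divr_gt0 r0 D0).
  exists m1 => m mm /=; have := m1P m mm; rewrite distrC ltr_pdivlMr// => h1.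
  rewrite mulrA; apply: le_lt_trans h1; rewrite [leRHS]mulrC ler_wpM2r// lerDl//.
(* Three errors of size [e / 3]: [S] against [Sk m] on the vectors above, [Sk m] against [Sk K] by
   the Cauchy property, and [Sk K] after [W] by the captured mass. The index [K] is fixed before the
   system, whereas [m] may depend on [ys]. *)
pose m := maxn K m0.
have -> : fsub (truncation M ys S) (truncation N xs S) = fun k =>
    (fsub S (Sk m) (W k) + fsub (Sk m) (Sk K) (W k)) + Sk K (W k).
  apply/funext => k; rewrite /fsub !truncation_proj// -(is_linearB _ _ lS) -/(W k).
  by rewrite addrA subrK subrK.
have lSm : is_linear (fun k => fsub S (Sk m) (W k)).
  move=> a u v; rewrite /fsub !lW !lS (finite_rank_linear hip (fS m)).
  by rewrite scalerBr opprD addrACA.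
have E1 : (fun k => fsub S (Sk m) (W k)) =
    frop ip M (fun l => A (ys l)) (fun l => fsub S (Sk m) (W (A (ys l)))).
  rewrite -(op_proj ip M (fun l => A (ys l)) lSm); apply/funext => k /=.
  by rewrite -WP.
have f1 : finite_rank ip (fun k => fsub S (Sk m) (W k)) by rewrite E1; exact: finite_rank_op.
have f2 : finite_rank ip (fun k => fsub (Sk m) (Sk K) (W k)).
  by apply: (finite_rank_comp hip) => //; exact: finite_rankB.
have f3 : finite_rank ip (fun k => Sk K (W k)) by exact: (finite_rank_comp hip).
apply: le_trans (fr_gnormD hip (finite_rankD hip f1 f2) f3) _.
have -> : e = e / 3 + e / 3 + e / 3 by field.
apply: lerD; first apply: le_trans (fr_gnormD hip f1 f2) _; first apply: lerD.
- rewrite E1; apply: le_trans (fr_gnorm_op_sum hip _ _ _) _.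
  by apply/ltW/m0P; rewrite leq_maxr.
- apply: le_trans (fr_gnorm_comp hip (finite_rankB hip (fS m) (fS K)) cW) _.
  by rewrite ltW// KP// leq_maxl.
- rewrite SK (comp_op L h x cW); apply: le_trans (fr_gnorm_op_sum hip _ _ _) _.
  apply: le_trans (_ : d * X <= _).
    rewrite /X mulr_sumr; apply: ler_sum => i _; rewrite [leRHS]mulrCA ler_wpM2l ?(ltW c0)//.
    by rewrite ler_wpM2r// Wh.
  rewrite /d mulrAC ler_pdivrMr ?ltr_wpDl// ler_wpM2l ?(ltW e3)//; lra.
Qed.

Lemma refines_upper N xs N' xs' : (forall i, (i < N)%N -> dual_elt (xs i)) ->
  (forall i, (i < N')%N -> dual_elt (xs' i)) ->
  exists M ys, [/\ system M ys, refines N xs M ys & refines N' xs' M ys].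
Proof.
move=> dx dx'.
pose z i := if (i < N)%N then xs i else xs' (i - N)%N.
have [|M [ys [sy zy]]] := @system_span (N + N') z.
  move=> i iN; rewrite /z; case: ifP => [/dx//|/negbT]; rewrite -leqNgt => Ni.
  by apply: dx'; rewrite ltn_subLR.
exists M, ys; split => // i iN.
  by have := zy i (ltn_addr N' iN); rewrite /z iN.
have := zy (N + i)%N; rewrite ltn_add2l => /(_ iN).
by rewrite /z ltnNge leq_addr/= addKn.
Qed.

(** The two systems are unrelated; each is compared with a common refinement. *)
Lemma truncation_cauchy T N xs e N' xs' e' : dominated T ->
  system N xs -> tolerance N xs e -> system N' xs' -> tolerance N' xs' e' ->
  fr_gnorm ip (fsub (truncation N xs T) (truncation N' xs' T)) <= e + e'.
Proof.
move=> dT sx tx sx' tx'; have [bT _] := dT.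
have [M [ys [sy xy x'y]]] := refines_upper sx.1 sx'.1.
have f1 := finite_rank_truncation sx bT; have f2 := finite_rank_truncation sx' bT.
have f3 := finite_rank_truncation sy bT.
apply: le_trans (fr_gnorm_tri hip f1 f3 f2) _; apply: lerD.
  rewrite (fr_gnormC hip)//; apply: le_trans (truncation_dominated dT sx sy xy) _.
  exact: tx.
by apply: le_trans (truncation_dominated dT sx' sy x'y) _; exact: tx'.
Qed.

(** Refine by [y] itself. The residual [u] then lies in the finer span and its squared norm is
    [y (U u)], with [U] the difference of the two truncations of [S]. *)
Lemma truncation_adj N xs e (y : E -> R^o) C : system N xs -> tolerance N xs e ->
  dual_elt y -> 0 <= C -> (forall z, `|y z| <= C * `|z|) ->
  c * `|A y - oproj ip N (fun i => A (xs i)) (A y)| <= C * e.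
Proof.
move=> sx tx dy C0 yC; have [dx ox] := sx.
have [M [ys [sy xy yy]]] := @refines_upper N xs 1 (fun=> y) dx (fun i _ => dy).
have ly : is_linear y by case: dy.
set u := A y - _.
have uP : oproj ip M (fun l => A (ys l)) u = u.
  rewrite /u (is_linearB _ _ (proj_linear hip M _)); congr (_ - _).
    by rewrite -(yy 0%N).
  transitivity (oproj ip M (fun l => A (ys l)) (\sum_(i < N) ip (A y) (A (xs i)) *: A (xs i))) => //.
  rewrite (is_linear_lincomb N (fun i => ip (A y) (A (xs i))) (fun i => A (xs i)) (proj_linear hip M _)).
  by apply: eq_bigr => i _; rewrite -xy.
pose U := fsub (truncation M ys S) (truncation N xs S).
have uU : ip u u = y (U u).
  rewrite /U /fsub (is_linearB _ _ ly) !truncation_proj// uP -!(adjP hip _ bS dy).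
  by rewrite -(proj_sym hip) -(ipBl hip).
have fU : finite_rank ip U by apply: finite_rankB => //; exact: finite_rank_truncation.
have [u0|u0] := eqVneq u 0.
  rewrite u0 normr0 mulr0 mulr_ge0//.
  exact: le_trans (fr_gnorm_ge0 ip U) (tx _ _ sy xy).
have u1 : 0 < `|u| by rewrite normr_gt0.
rewrite -(ler_pM2r u1) -mulrA -expr2 -(ipxx hip) uU.
apply: le_trans (_ : c * (C * `|U u|) <= _).
  by apply: ler_wpM2l => //; apply: le_trans (yC _); exact: ler_norm.
rewrite mulrCA -mulrA; apply: ler_wpM2l => //.
apply: le_trans (fr_gnorm_bound hip u fU) _.
by apply: ler_wpM2r => //; exact: tx.
Qed.

(** The difference is the pairing of [k] with [T^*] of a functional; domination replaces [T^*] by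
    [S^*], and [truncation_adj] bounds the result. *)
Lemma truncation_weak T N xs e (y : E -> R^o) C k : dominated T ->
  system N xs -> tolerance N xs e ->
  dual_elt y -> 0 <= C -> (forall z, `|y z| <= C * `|z|) ->
  c * `|y (truncation N xs T k) - y (T k)| <= C * e * `|k|.
Proof.
move=> dT sx tx dy C0 yC; have [dx ox] := sx; have [bT dT'] := dT.
have ly : is_linear y by case: dy.
pose b i := ip (A y) (A (xs i)).
have dz := dual_comb (-1) dy (dual_dsum b dx).
have -> : y (truncation N xs T k) - y (T k) = ip (adj ip T (fun e => -1 * y e + dsum N b xs e)) k.
  rewrite (adjP hip)// mulN1r addrC; congr (_ + _).
  rewrite /truncation (is_linear_lincomb N (fun i => xs i (T k)) (fun i => S (A (xs i))) ly).
  by apply: eq_bigr => i _; rewrite /b (adjP hip)// -[_ *: _]/(_ * _) mulrC.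
apply: le_trans (_ : c * (`|A (fun e => -1 * y e + dsum N b xs e)| * `|k|) <= _).
  apply: ler_wpM2l; first exact: ltW.
  by apply: le_trans (ip_CS hip _ _) _; apply: ler_wpM2r => //; exact: dT'.
rewrite mulrA; apply: ler_wpM2r => //.
rewrite (adj_comb hip)//; last exact: dual_dsum.
rewrite (adj_dsum hip)// scaleN1r -normrN opprD opprK.
exact: (truncation_adj sx tx dy C0 yC).
Qed.

(** This puts every dominated operator into gamma(H,E), with an approximating sequence given by
    systems that do not depend on [T]. *)
Lemma dominated_approx T (N : nat -> nat) (xs : nat -> nat -> E -> R^o) :
  dominated T -> (forall n, system (N n) (xs n)) ->
  (forall n, tolerance (N n) (xs n) n.+1%:R^-1) ->
  gamma_approx ip (fun n => truncation (N n) (xs n) T) T.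
Proof.
move=> dT sx tx; have [bT _] := dT.
have fT n := finite_rank_truncation (sx n) bT.
have tc m n := truncation_cauchy dT (sx m) (tx m) (sx n) (tx n).
have cau : fr_cauchy ip (fun n => truncation (N n) (xs n) T).
  move=> e e0; have e2 : 0 < e / 2 by rewrite divr_gt0.
  have [K KP] := inv_succ_lt e2; exists K => m n Km Kn.
  by apply: le_lt_trans (tc m n) _; rewrite (splitr e) ltrD// KP.
split => // k.
have [z zP] : exists z : E, (fun n => truncation (N n) (xs n) T k) @ \oo --> z.
  apply: cauchy_seq_cvg => e e0.
  have k1 : 0 < `|k| + 1 by rewrite ltr_wpDl.
  have [K KP] := cau _ (divr_gt0 (mulr_gt0 c0 e0) k1); exists K => m n Km Kn.
  have := KP m n Km Kn; rewrite ltr_pdivlMr// => h1.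
  rewrite -(ltr_pM2l c0).
  apply: le_lt_trans (fr_gnorm_bound hip k (finite_rankB hip (fT m) (fT n))) _.
  by apply: le_lt_trans h1; rewrite ler_wpM2l ?fr_gnorm_ge0// lerDl.
suff -> : T k = z by [].
have [f [df fz]] := hahn_banach (T k - z).
have [lf [C [C0 fC]]] := (bounded_linearP _).1 df.
apply/eqP; rewrite -subr_eq0 -normr_le0 -fz; apply/ler_addgt0Pr => e e0; rewrite add0r.
have e2 : 0 < e / 2 by rewrite divr_gt0.
have [K1 P1] := (cvg_seqP _ _).1 zP _ (divr_gt0 e2 C0).
have D0 : 0 < C * (`|k| + 1) / c by rewrite divr_gt0// mulr_gt0// ltr_wpDl.
have [K2 P2] := inv_succ_lt (divr_gt0 e2 D0).
pose n := maxn K1 K2.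
set t := truncation (N n) (xs n) T k.
have h1 : `|t - z| < e / 2 / C by apply: P1; rewrite leq_maxl.
have h2 : n.+1%:R^-1 < e / 2 / (C * (`|k| + 1) / c) by apply: P2; rewrite leq_maxr.
have h3 : c * `|f t - f (T k)| <= C * n.+1%:R^-1 * `|k|.
  exact: (truncation_weak k dT (sx n) (tx n) df (ltW C0) fC).
have -> : f (T k - z) = f (t - z) - (f t - f (T k)).
  by rewrite !(is_linearB _ _ lf) opprB [RHS]addrC addrA subrK.
apply: le_trans (ler_norm _) _; apply: le_trans (ler_normB _ _) _.
rewrite (splitr e); apply: lerD.
  by apply: le_trans (fC _) _; rewrite mulrC -ler_pdivlMr// ltW.
rewrite -(ler_pM2l c0); apply: le_trans h3 _.
move: h2; rewrite ltr_pdivlMr// mulrA ltr_pdivrMr// => /ltW h2.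
rewrite [leRHS]mulrC; apply: le_trans h2; rewrite -mulrA mulrCA ler_wpM2l ?invr_ge0//.
by rewrite ler_pM2l// lerDl.
Qed.

End domination.

(** * Relative compactness *)

Section rel_compact.
Context {R : realType} {H E : completeNormedModType R}.
Variable ip : H -> H -> R.
Hypothesis hip : inner_product ip.
Notation c := (Num.sqrt (@normal_sqr R)).

(** A sequence of adjoint vectors is lifted to [TT]; two late terms of a gamma-convergent
    subsequence supply the close pair asked for by [precompact_seq]. *)
Lemma rel_compact_gamma_adj (TT : set (H -> E)) (xs : E -> R^o) :
  rel_compact_gamma ip TT -> dual_elt xs ->
  compact (closure [set adj ip T xs | T in TT]).
Proof.
move=> [TTg cTT] dx; apply: precompact_seq => e u e0 uA.
have /choice[T TP] n : exists T, TT T /\ adj ip T xs = u n.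
  by have [T TTT Tu] := uA n; exists T.
have [phi [phi_incr [U [gU cU]]]] := cTT T (fun n => (TP n).1).
have [lx [C [C0 xC]]] := (bounded_linearP _).1 dx.
have c0 : 0 < c := sqrt_normal_sqr_gt0.
have e2 : 0 < e / 2 by rewrite divr_gt0.
have [L LP] := (@cvg_seqP R R^o _ _).1 cU _ (divr_gt0 (mulr_gt0 c0 e2) C0).
have close j : (L <= j)%N -> `|u (phi j) - adj ip U xs| < e / 2.
  move=> Lj; have [TTj <-] := TP (phi j); have gj := TTg _ TTj.
  rewrite -(ltr_pM2l c0); apply: le_lt_trans (adj_dist hip gj gU dx (ltW C0) xC) _.
  have := LP j Lj; rewrite subr0 => /(le_lt_trans (ler_norm _)).
  by rewrite ltr_pdivlMr// mulrC.
exists (phi L), (phi L.+1); split; first exact: phi_incr.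
rewrite (le_lt_trans (ler_distD (adj ip U xs) _ _))// (splitr e) ltrD ?close//.
by rewrite distrC close.
Qed.

Lemma increasing_selection (P : nat -> nat -> Prop) :
  (forall n J, exists2 j, (J < j)%N & P n j) ->
  exists phi : nat -> nat, {homo phi : m n / (m < n)%N >-> (m < n)%N} /\ forall n, P n (phi n).
Proof.
move=> hP.
have /choice[f fP] (q : nat * nat) : exists j, (q.2 < j)%N /\ P q.1 j.
  by have [j] := hP q.1 q.2; exists j.
pose phi := fix phi n := if n is m.+1 then f (m.+1, phi m) else f (0%N, 0%N).
exists phi; split; last by case=> [|n]; [case: (fP (0%N, 0%N))|case: (fP (n.+1, phi n))].
by apply: homo_ltn => [? ? ?|n]; [exact: ltn_trans|case: (fP (n.+1, phi n))].
Qed.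

Variable S : H -> E.
Hypothesis hS : in_gamma ip S.

(* Along an ultrafilter finer than [\oo] all the sequences (u j)^* xs converge
   simultaneously, which replaces a diagonal extraction. *)
Lemma dominated_rel_compact (TT : set (H -> E)) :
  (forall T, TT T -> dominated ip S T) ->
  (forall xs : E -> R^o, dual_elt xs -> compact (closure [set adj ip T xs | T in TT])) ->
  rel_compact_gamma ip TT.
Proof.
move=> dTT cTT.
have c0 : 0 < c := sqrt_normal_sqr_gt0.
have /choice[sg sgP] n : exists sg : nat * (nat -> E -> R^o),
    system ip S sg.1 sg.2 /\ tolerance ip S sg.1 sg.2 n.+1%:R^-1.
  have n0 : 0 < n.+1%:R^-1 :> R by rewrite invr_gt0.
  by have [N [xs sx]] := tolerance_exists hip hS n0; exists (N, xs).
pose N n := (sg n).1; pose xs n := (sg n).2.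
have sx n : system ip S (N n) (xs n) by case: (sgP n).
have tx n : tolerance ip S (N n) (xs n) n.+1%:R^-1 by case: (sgP n).
pose Q n T := truncation ip S (N n) (xs n) T.
have QT T : TT T -> gamma_approx ip (fun n => Q n T) T.
  by move=> /dTT dT; exact: (dominated_approx hip hS dT sx tx).
have fQ n T : TT T -> finite_rank ip (Q n T).
  by move=> /dTT[bT _]; exact: (finite_rank_truncation hip (sx n) bT).
have cQ m n T : TT T -> fr_gnorm ip (fsub (Q m T) (Q n T)) <= m.+1%:R^-1 + n.+1%:R^-1.
  by move=> /dTT dT; exact: (truncation_cauchy hip hS dT (sx m) (tx m) (sx n) (tx n)).
split; first by move=> T /QT aT; exists (fun n => Q n T).
move=> u uTT.
have [U [UU ooU]] := @ultraFilterLemma nat \oo _.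
have /choice[a aP] (q : nat * nat) : exists a, (q.2 < N q.1)%N -> forall e : R, 0 < e ->
    U [set j | `|adj ip (u j) (xs q.1 q.2) - a| < e].
  have [qN|] := boolP (q.2 < N q.1)%N; last by exists 0.
  have dq := (sx q.1).1 q.2 qN.
  have [|p pP] := ultra_compact_cvg (a := fun j => adj ip (u j) (xs q.1 q.2)) UU (cTT _ dq).
    by move=> j; apply: subset_closure; exists (u j).
  by exists p.
(* The limit along [U] of the [n]-th truncations of [u j]: by [truncationE] these depend on [j] only
   through finitely many adjoint vectors, here replaced by their limits. *)
pose V n := frop ip (N n) (fun i => a (n, i)) (fun i => S (adj ip S (xs n i))).
have fV n : finite_rank ip (V n) by exact: finite_rank_op.
have QV n e : 0 < e -> U [set j | fr_gnorm ip (fsub (Q n (u j)) (V n)) < e].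
  move=> e0.
  apply: filterS (@filter_sum_lt R nat U _ (N n) (fun i j => c *
    (`|adj ip (u j) (xs n i) - a (n, i)| * `|S (adj ip S (xs n i))|)) _ e e0).
    move=> j /=; apply: le_lt_trans.
    rewrite (_ : fsub _ _ = frop ip (N n) (fun i => adj ip (u j) (xs n i) - a (n, i))
      (fun i => S (adj ip S (xs n i)))); first exact: (fr_gnorm_op_sum hip).
    have [bj _] := dTT _ (uTT j).
    apply/funext => k; rewrite /fsub /Q (truncationE hip (sx n) bj) /V /frop -sumrB.
    by apply: eq_bigr => i _; rewrite -scalerBl (ipBr hip).
  move=> i iN d d0.
  pose D := c * `|S (adj ip S (xs n i))| + 1.
  have D0 : 0 < D by rewrite ltr_wpDl// mulr_ge0// ltW.
  apply: filterS (aP (n, i) iN _ (divr_gt0 d0 D0)) => j /=.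
  rewrite ltr_pdivlMr// => h1; apply: le_lt_trans h1.
  by rewrite mulrCA ler_wpM2l// lerDl.
(* The bound [cQ] is uniform in [u j], so it survives the limit: some single [j] is good for both
   [m] and [n]. *)
have cV m n : fr_gnorm ip (fsub (V m) (V n)) <= m.+1%:R^-1 + n.+1%:R^-1.
  apply/ler_addgt0Pr => e e0; have e2 : 0 < e / 2 by rewrite divr_gt0.
  have [j [/= jm jn]] := filter_ex (filterI (QV m _ e2) (QV n _ e2)).
  have fm := fQ m _ (uTT j); have fn := fQ n _ (uTT j).
  apply: le_trans (fr_gnorm_tri hip (fV m) fm (fV n)) _.
  rewrite (fr_gnormC hip (fV m) fm).
  have := fr_gnorm_tri hip fm fn (fV n); have := cQ m n _ (uTT j).
  by move: (m.+1%:R^-1) (n.+1%:R^-1) => p q; lra.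
have cauV : fr_cauchy ip V.
  move=> e e0; have e2 : 0 < e / 2 by rewrite divr_gt0.
  have [K KP] := inv_succ_lt e2; exists K => m n Km Kn.
  by apply: le_lt_trans (cV m n) _; rewrite (splitr e) ltrD// KP.
have /choice[T TP] k : exists z : E, (fun n => V n k) @ \oo --> z.
  apply: cauchy_seq_cvg => e e0.
  have k1 : 0 < `|k| + 1 by rewrite ltr_wpDl.
  have [K KP] := cauV _ (divr_gt0 (mulr_gt0 c0 e0) k1); exists K => m n Km Kn.
  have := KP m n Km Kn; rewrite ltr_pdivlMr// => h1.
  rewrite -(ltr_pM2l c0).
  apply: le_lt_trans (fr_gnorm_bound hip k (finite_rankB hip (fV m) (fV n))) _.
  by apply: le_lt_trans h1; rewrite ler_wpM2l ?fr_gnorm_ge0// lerDl.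
have aT : gamma_approx ip V T by split.
have gT : in_gamma ip T by exists V.
(* Go from [Q m (u j)] to [V m] through [Q n (u j)] and [V n]: the outer steps cost
   [m.+1%:R^-1 + n.+1%:R^-1] each, at most [4 * n.+1%:R^-1] in all for [m >= n]. This explains
   [e / 5] below. *)
have gle n j : Defs.gnorm ip (fsub (u j) T) <= 4 * n.+1%:R^-1 + fr_gnorm ip (fsub (Q n (u j)) (V n)).
  apply: (gnorm_le (K := n) hip (gamma_approx_sub hip (QT _ (uTT j)) aT)) => m nm.
  have mn : m.+1%:R^-1 <= n.+1%:R^-1 :> R by rewrite lef_pV2 ?posrE// ler_nat ltnS.
  have fm := fQ m _ (uTT j); have fn := fQ n _ (uTT j).
  have := fr_gnorm_tri hip fm fn (fV m); have := fr_gnorm_tri hip fn (fV n) (fV m).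
  have := cQ m n _ (uTT j); have := cV n m.
  move: (m.+1%:R^-1) (n.+1%:R^-1) mn => p q; lra.
have gU e : 0 < e -> U [set j | Defs.gnorm ip (fsub (u j) T) < e].
  move=> e0; have e5 : 0 < e / 5 by rewrite divr_gt0.
  have [K KP] := inv_succ_lt e5.
  apply: filterS (QV K _ e5) => j /= h1; have := gle K j; have := KP K (leqnn K).
  by move: (K.+1%:R^-1) => p; lra.
have [|phi [phi_incr phiP]] := @increasing_selection
    (fun n j => Defs.gnorm ip (fsub (u j) T) < n.+1%:R^-1).
  move=> n J; have n0 : 0 < n.+1%:R^-1 :> R by rewrite invr_gt0.
  (* As [U] refines [\oo] it contains every tail, so arbitrarily late good indices exist and a
     genuine subsequence can be selected. *)
  have JU : U [set j | (J < j)%N] by apply: ooU; apply/filter_inftyP; exists J.+1.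
  by have [j [/= Jj gj]] := filter_ex (filterI JU (gU _ n0)); exists j.
exists phi; split => //; exists T; split => //.
apply/(@cvg_seqP R R^o) => e e0; have [K KP] := inv_succ_lt e0; exists K => n Kn.
rewrite subr0 ger0_norm; first by apply: lt_trans (phiP n) (KP n Kn).
by apply: (gnorm_ge0 hip); apply: (in_gammaB hip) => //; exists (fun m => Q m (u (phi n))); exact: QT.
Qed.

End rel_compact.

Theorem theorem9p3 (R : realType) (H : completeNormedModType R)
  (E : completeNormedModType R) (ip : H -> H -> R)
  (hip : inner_product ip) (S : H -> E) (hS : in_gamma ip S)
  (TT : set (H -> E)) (hTT : forall T, TT T -> bounded_linear T)
  (hdom : forall T, TT T -> forall xs : E -> R^o, dual_elt xs ->
     `|adj ip T xs| <= `|adj ip S xs|) :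
  rel_compact_gamma ip TT <->
  (forall xs : E -> R^o, dual_elt xs ->
     compact (closure [set adj ip T xs | T in TT])).
Proof.
split=> [cTT xs dx|cTT]; first exact: rel_compact_gamma_adj.
by apply: (dominated_rel_compact hip hS) => // T TTT; split; [exact: hTT|exact: hdom].
Qed.
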